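(* Let $K$ be an algebraically closed field and let $\Lambda=KQ/I$ be a basic and connected finite dimensional $K$-algebra, where $Q$ is a finite quiver and $I$ is an admissible ideal of $KQ$. Then $\Lambda$ is right $2$-Nakayama if and only if $(Q,I)$ satisfies the following conditions: (i) For every $a\in Q_0$, $|a^+|\le 2$ and $|a^-|\le 1$. (ii) For every $\alpha\in Q_1$, there is at most one arrow $\beta$ such that $\alpha\beta\notin I$. (iii) There exists $a\in Q_0$ such that $|a^+|=2$. (iv) For all non-lazy paths $\sigma$ and $\gamma$ such that $\sigma$ and $\gamma$ have the same source and neither is $\sigma$ a subpath of $\gamma$ nor is $\gamma$ a subpath of $\sigma$, one has $\mathrm{length}(\sigma)+\mathrm{length}(\gamma)=2$.
   Context: $Q_0$ and $Q_1$ denote the sets of vertices and arrows of $Q$. For a vertex $a\in Q_0$, $a^+$ denotes the set of arrows starting at $a$ and $a^-$ the set of arrows ending at $a$. A path is non-lazy if it has positive length. Paths are composed from left to right ($\alpha\beta$ means first $\alpha$, then $\beta$), so that right $\Lambda$-modules correspond to (covariant) representations of $(Q,I)$ and the indecomposable projective right module at $a$ is spanned by the classes of paths starting at $a$. All modules are finitely generated right $\Lambda$-modules. For a module $M$ put $\mathrm{rad}^0(M)=M$, $\mathrm{rad}^{i+1}(M)=\mathrm{rad}(\mathrm{rad}^i(M))$. A module is uniserial if it has a unique composition series (the zero module counts as uniserial). Let $M$ be a nonzero module of length $l$. $M$ is $1$-factor serial if it is uniserial; for $l\ge 2$, $M$ is $2$-factor serial if $M/\mathrm{rad}^{l-2}(M)$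 is uniserial and $M/\mathrm{rad}^{l-1}(M)$ is not uniserial. $\Lambda$ is right $2$-Nakayama if every indecomposable right $\Lambda$-module is $1$-factor serial or $2$-factor serial and there exists at least one indecomposable $2$-factor serial right $\Lambda$-module.
   Formalization: In (iv), paths are restricted to those not lying in I, and ''subpath'' means initial subpath; over all paths of Q the claim fails for c ←β– a –α→ b –δ→ d with I = (αδ), and with arbitrary subpaths of nonzero paths it fails for a loop α at a, an arrow β: a→b and I = (α²). *)

(* Defs.v *)
From HB Require Import structures.
From mathcomp Require Import all_boot all_order all_algebra.
From mathcomp Require Import boolp classical_sets functions.
From mathcomp Require Import finmap.
From mathcomp.multinomials Require Import monalg.

Set Implicit Arguments.
Unset Strict Implicit.
Unset Printing Implicit Defensive.

Import GRing.Theory.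
Local Open Scope ring_scope.
Local Open Scope quotient_scope.
Local Open Scope classical_set_scope.

(** * Modules *)

Section Submodules.
Variables (R : pzRingType) (M : lmodType R).

Definition is_submodule (U : set M) :=
  U 0 /\ forall (a : R) (x y : M), U x -> U y -> U (a *: x + y).

Record submodule := Submodule {
  submod_set :> M -> Prop;
  submodP : is_submodule submod_set }.

Lemma whole_submod : is_submodule setT. Proof. by []. Qed.

Definition is_maximal_submodule (N U : set M) :=
  [/\ is_submodule N, N `<` U
    & forall L, is_submodule L -> N `<=` L -> L `<=` U -> L = N \/ L = U].

Definition rad_set (U : set M) : set M :=
  [set x | U x /\ forall N, is_maximal_submodule N U -> N x].

Lemma rad_submod (U : submodule) : is_submodule (rad_set U).
Proof.
have [U0 UD] := submodP U.
split=> [|a x y [Ux rx] [Uy ry]].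
  by split=> // N [[]].
split=> [|N maxN]; first exact: UD.
by have [[_ ND] _ _] := maxN; apply: ND; [apply: rx | apply: ry].
Qed.

Definition rad (U : submodule) : submodule := Submodule (rad_submod U).

Definition rad_pow (i : nat) : submodule :=
  iter i rad (Submodule whole_submod).

(* [s] lists the terms M_1, ..., M_l of a series 0 = M_0 < M_1 < ... < M_l = M
   with simple factors; the term M_0 = 0 is left out, so that the length of the
   series is [size s]. *)
Definition composition_series (s : seq (set M)) :=
  last [set 0] s = setT /\
  forall i, (i < size s)%N ->
    is_maximal_submodule (nth setT ([set 0] :: s) i) (nth setT s i).

Definition has_length (l : nat) :=
  exists2 s, composition_series s & size s = l.

Definition uniserial := exists! s, composition_series s.

Definition nonzero_module := exists x : M, x <> 0.

Definition indecomposable :=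
  nonzero_module /\
  forall U V : set M, is_submodule U -> is_submodule V ->
    U `&` V = [set 0] -> (forall x, exists u v, [/\ U u, V v & x = u + v]) ->
    U = [set 0] \/ V = [set 0].

Definition finitely_generated :=
  exists (n : nat) (g : 'I_n -> M),
    forall x, exists c : 'I_n -> R, x = \sum_i c i *: g i.

End Submodules.

Section QuotientModule.
Variables (R : pzRingType) (M : lmodType R) (U : submodule M).

Definition submod_pred : {pred M} := fun x => `[< U x >].

Lemma submod_predP x : reflect (U x) (x \in submod_pred).
Proof. exact: asboolP. Qed.

Fact submod_pred_zmod : zmod_closed submod_pred.
Proof.
have [U0 UD] := submodP U.
split=> [|x y /submod_predP Ux /submod_predP Uy]; apply/submod_predP => //.
by rewrite addrC -scaleN1r; apply: UD.
Qed.

HB.instance Definition _ := GRing.isZmodClosed.Build M submod_pred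
  submod_pred_zmod.

Definition quot_module := Quotient.quot submod_pred.

HB.instance Definition _ := GRing.Zmodule.on quot_module.
HB.instance Definition _ := EqQuotient.on quot_module.

Definition quot_proj : M -> quot_module := \pi_quot_module.

Lemma quot_projK x : quot_proj (repr x) = x. Proof. exact: reprK. Qed.

Lemma quot_projP x y : quot_proj x = quot_proj y <-> U (x - y).
Proof.
split=> [/eqP|/submod_predP Uxy]; last by apply/eqP; rewrite -Quotient.idealrBE.
by rewrite -Quotient.idealrBE => /submod_predP.
Qed.

Lemma quot_projD x y : quot_proj (x + y) = quot_proj x + quot_proj y.
Proof. exact: Quotient.pi_add. Qed.

Definition quot_scale (a : R) (x : quot_module) : quot_module :=
  quot_proj (a *: repr x).

Lemma quot_scale_proj a x : quot_scale a (quot_proj x) = quot_proj (a *: x).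
Proof.
have [U0 UD] := submodP U.
have /quot_projP Uz := quot_projK (quot_proj x).
by apply/quot_projP; rewrite -scalerBr -[_ *: _]addr0; exact: (UD a _ 0 Uz U0).
Qed.

Fact quot_scaleA a b x : quot_scale a (quot_scale b x) = quot_scale (a * b) x.
Proof. by rewrite {2}/quot_scale quot_scale_proj scalerA. Qed.

Fact quot_scale1 : left_id 1 quot_scale.
Proof. by move=> x; rewrite /quot_scale scale1r quot_projK. Qed.

Fact quot_scaleDr : right_distributive quot_scale +%R.
Proof.
move=> a x y; rewrite -(quot_projK x) -(quot_projK y).
by rewrite -quot_projD !quot_scale_proj scalerDr quot_projD.
Qed.

Fact quot_scaleDl x : {morph quot_scale^~ x : a b / a + b}.
Proof. by move=> a b; rewrite /quot_scale scalerDl quot_projD. Qed.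

HB.instance Definition _ := GRing.Zmodule_isLmodule.Build R quot_module
  quot_scaleA quot_scale1 quot_scaleDr quot_scaleDl.

End QuotientModule.

Section FactorSerial.
Variables (R : pzRingType) (M : lmodType R).

Definition one_factor_serial := nonzero_module M /\ uniserial M.

Definition two_factor_serial :=
  exists l, [/\ has_length M l, (2 <= l)%N,
    uniserial (quot_module (rad_pow M (l - 2)))
    & ~ uniserial (quot_module (rad_pow M (l - 1)))].

End FactorSerial.

(* A right [R]-module is a left module over the converse ring [R^c]. *)
Definition right_2_Nakayama (R : pzRingType) :=
  (forall M : lmodType R^c, finitely_generated M -> indecomposable M ->
     one_factor_serial M \/ two_factor_serial M) /\
  (exists M : lmodType R^c,
     [/\ finitely_generated M, indecomposable M & two_factor_serial M]).

(** * Basic and connected rings *)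

Section BasicConnected.
Variable R : pzRingType.

Definition primitive_idempotent (e : R) :=
  [/\ e * e = e, e <> 0
    & forall f g : R, f * f = f -> g * g = g -> f * g = 0 -> g * f = 0 ->
        e = f + g -> f = 0 \/ g = 0].

Definition complete_primitive_orthogonal n (e : 'I_n -> R) :=
  [/\ forall i, primitive_idempotent (e i),
      forall i j, i != j -> e i * e j = 0
    & \sum_i e i = 1].

Definition right_ideal_iso (U V : set R) :=
  exists f : R -> R,
    [/\ set_bij U V f,
        forall x y, U x -> U y -> f (x + y) = f x + f y
      & forall x r, U x -> f (x * r) = f x * r].

Definition principal_right_ideal (e : R) : set R := [set e * x | x in setT].

Definition basic :=
  forall n (e : 'I_n -> R), complete_primitive_orthogonal e ->
  forall i j, i != j ->
    ~ right_ideal_iso (principal_right_ideal (e i))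
                      (principal_right_ideal (e j)).

Definition connected :=
  forall (R1 R2 : pzRingType) (f : {rmorphism R -> (R1 * R2)%type}),
    bijective f -> (forall x : R1, x = 0) \/ (forall x : R2, x = 0).

End BasicConnected.

(** * Two-sided ideals and quotient rings *)

Section Ideals.
Variable A : pzRingType.

Definition is_ideal (I : set A) :=
  [/\ I 0, forall x y, I x -> I y -> I (x + y),
      forall a x, I x -> I (a * x) & forall x a, I x -> I (x * a)].

Record ideal := Ideal {
  ideal_set :> A -> Prop;
  idealP : is_ideal ideal_set }.

Definition ideal_generated (S : set A) : set A :=
  [set x | forall J, is_ideal J -> S `<=` J -> J x].

Definition ideal_mul (I J : set A) : set A :=
  ideal_generated [set x * y | x in I & y in J].

Definition ideal_pow (I : set A) (n : nat) : set A :=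
  iter n (ideal_mul I) setT.

End Ideals.

Section QuotientRing.
Variables (A : pzRingType) (I : ideal A).

Definition ideal_pred : {pred A} := fun x => `[< I x >].

Lemma ideal_predP x : reflect (I x) (x \in ideal_pred).
Proof. exact: asboolP. Qed.

Fact ideal_pred_zmod : zmod_closed ideal_pred.
Proof.
have [I0 ID IMl _] := idealP I.
split=> [|x y /ideal_predP Ix /ideal_predP Iy]; apply/ideal_predP => //.
by apply: ID => //; rewrite -mulN1r; apply: IMl.
Qed.

HB.instance Definition _ := GRing.isZmodClosed.Build A ideal_pred
  ideal_pred_zmod.

Definition quot_ring := Quotient.quot ideal_pred.

HB.instance Definition _ := GRing.Zmodule.on quot_ring.
HB.instance Definition _ := EqQuotient.on quot_ring.

Definition quot_class : A -> quot_ring := \pi_quot_ring.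

Lemma quot_classK x : quot_class (repr x) = x. Proof. exact: reprK. Qed.

Lemma quot_classP x y : quot_class x = quot_class y <-> I (x - y).
Proof.
split=> [/eqP|/ideal_predP Ixy]; last by apply/eqP; rewrite -Quotient.idealrBE.
by rewrite -Quotient.idealrBE => /ideal_predP.
Qed.

Lemma quot_classD x y : quot_class (x + y) = quot_class x + quot_class y.
Proof. exact: Quotient.pi_add. Qed.

Lemma quot_ringW (P : quot_ring -> Prop) :
  (forall x, P (quot_class x)) -> forall x, P x.
Proof. by move=> Pc x; rewrite -(quot_classK x). Qed.

Definition quot_mul (x y : quot_ring) : quot_ring :=
  quot_class (repr x * repr y).

Lemma quot_mul_class x y :
  quot_mul (quot_class x) (quot_class y) = quot_class (x * y).
Proof.
have [I0 ID IMl IMr] := idealP I.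
have reprB z : I (repr (quot_class z) - z) by apply/quot_classP/quot_classK.
apply/quot_classP; set x' := repr _; set y' := repr _.
have -> : x' * y' - x * y = (x' - x) * y' + x * (y' - y).
  by rewrite mulrBl mulrBr addrA subrK.
by apply: ID; [apply: IMr | apply: IMl]; apply: reprB.
Qed.

Fact quot_mulA : associative quot_mul.
Proof.
elim/quot_ringW=> x; elim/quot_ringW=> y; elim/quot_ringW=> z.
by rewrite !quot_mul_class mulrA.
Qed.

Fact quot_mul1l : left_id (quot_class 1) quot_mul.
Proof. by elim/quot_ringW=> x; rewrite quot_mul_class mul1r. Qed.

Fact quot_mul1r : right_id (quot_class 1) quot_mul.
Proof. by elim/quot_ringW=> x; rewrite quot_mul_class mulr1. Qed.

Fact quot_mulDl : left_distributive quot_mul +%R.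
Proof.
elim/quot_ringW=> x; elim/quot_ringW=> y; elim/quot_ringW=> z.
by rewrite -quot_classD !quot_mul_class mulrDl quot_classD.
Qed.

Fact quot_mulDr : right_distributive quot_mul +%R.
Proof.
elim/quot_ringW=> x; elim/quot_ringW=> y; elim/quot_ringW=> z.
by rewrite -quot_classD !quot_mul_class mulrDr quot_classD.
Qed.

HB.instance Definition _ := GRing.Zmodule_isPzRing.Build quot_ring
  quot_mulA quot_mul1l quot_mul1r quot_mulDl quot_mulDr.

End QuotientRing.

(** * Quivers and path algebras *)

Record quiver := Quiver {
  vertex : finType;
  arrow : finType;
  src : arrow -> vertex;
  tgt : arrow -> vertex }.

Section Paths.
Variable Q : quiver.

Definition out_arrows (a : vertex Q) : {set arrow Q} := [set x | src x == a].
Definition in_arrows (a : vertex Q) : {set arrow Q} := [set x | tgt x == a].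

(* A path is its source together with the sequence of its arrows, in the order
   in which they are traversed; the source only matters for lazy paths. *)
Definition is_qpath (p : vertex Q * seq (arrow Q)) : bool :=
  if p.2 is x :: s
  then (src x == p.1) && path (fun y z => tgt y == src z) x s
  else true.

Record qpath := QPath {
  qpath_val : vertex Q * seq (arrow Q);
  qpathP : is_qpath qpath_val }.

HB.instance Definition _ := [isSub for qpath_val].
(* Opaque instances: with those inherited by the subtype, each rewriting in
   {malg K[qpath]} takes minutes. *)
HB.instance Definition _ := gen_eqMixin qpath.
HB.instance Definition _ := gen_choiceMixin qpath.

Definition psource (p : qpath) : vertex Q := (qpath_val p).1.
Definition parrows (p : qpath) : seq (arrow Q) := (qpath_val p).2.
Definition ptarget (p : qpath) : vertex Q :=
  last (psource p) (map (@tgt Q) (parrows p)).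
Definition plength (p : qpath) : nat := size (parrows p).

Definition lazy_path (a : vertex Q) : qpath :=
  @QPath (a, [::]) isT.

Fact arrow_path_subproof (x : arrow Q) : is_qpath (src x, [:: x]).
Proof. by rewrite /is_qpath /= eqxx. Qed.

Definition arrow_path (x : arrow Q) : qpath := QPath (arrow_path_subproof x).

(* For paths with the same source, "p is a subpath of q" means that q continues
   p; it does not mean that p occurs anywhere inside q. *)
Definition initial_subpath (p q : qpath) : bool :=
  (psource p == psource q) && prefix (parrows p) (parrows q).

Fact path_cat_subproof (p q : qpath) : ptarget p = psource q ->
  is_qpath (psource p, parrows p ++ parrows q).
Proof.
case: p q => [[a s] /= sP] [[b t] /= tP].
rewrite /ptarget /psource /parrows /=.
case: s sP => [_ /= ->|x s]; first exact: tP.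
rewrite /is_qpath /= => /andP[-> sP] eq_b; rewrite cat_path sP /=.
case: t tP => //= y t /andP[/eqP -> ->]; rewrite andbT -eq_b.
by rewrite last_map.
Qed.

(* The path [p] followed by [q], when they are composable. *)
Definition path_comp (p q : qpath) : option qpath :=
  match ptarget p =P psource q with
  | ReflectT pq => Some (QPath (path_cat_subproof pq))
  | ReflectF _ => None
  end.

End Paths.

Section PathCompTheory.
Variable Q : quiver.
Implicit Types p q r : qpath Q.

Variant path_comp_spec p q : option (qpath Q) -> Prop :=
| PathComp r of ptarget p = psource q
    & qpath_val r = (psource p, parrows p ++ parrows q) :
    path_comp_spec p q (Some r)
| PathNoComp of ptarget p <> psource q : path_comp_spec p q None.

Lemma path_compP p q : path_comp_spec p q (path_comp p q).
Proof.
by rewrite /path_comp; case: (ptarget p =P psource q) => ?; constructor.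
Qed.

Lemma path_comp_lazyl a p :
  path_comp (lazy_path a) p = if a == psource p then Some p else None.
Proof.
case: path_compP => [r|] /eqP; rewrite {1}/ptarget /=; last by move/negPf->.
move=> ap; rewrite (ap) => rE; congr Some; apply/val_inj.
move/eqP: ap; rewrite {1}/psource /= => ap.
by rewrite rE {1}/psource /= ap /psource /parrows; case: (qpath_val p).
Qed.

Lemma path_comp_lazyr a p :
  path_comp p (lazy_path a) = if ptarget p == a then Some p else None.
Proof.
case: path_compP => [r|] /eqP; rewrite [psource _]/=; last by move/negPf->.
move=> ap; rewrite (ap) => rE; congr Some; apply/val_inj.
by rewrite /= rE cats0 /psource /parrows; case: (qpath_val p).
Qed.

Lemma path_compA p q r :
  obind (fun s => path_comp s r) (path_comp p q) =
  obind (path_comp p) (path_comp q r).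
Proof.
case: (path_compP p q) => [s pq sE|npq]; case: (path_compP q r) => [t qr tE|nqr] //=.
- have st : ptarget s = ptarget q.
    rewrite /ptarget {1}/psource {1}/parrows sE /= map_cat last_cat.
    by rewrite -/(ptarget p) pq.
  case: path_compP => [u sr uE|]; last by rewrite st.
  case: path_compP => [v pt vE|[]]; last by rewrite pq /psource tE.
  congr Some; apply/val_inj.
  by rewrite /= uE vE /psource /parrows sE tE /= catA.
- have st : ptarget s = ptarget q.
    rewrite /ptarget {1}/psource {1}/parrows sE /= map_cat last_cat.
    by rewrite -/(ptarget p) pq.
  by case: path_compP => // u; rewrite st.
- case: path_compP => // v; rewrite {1}/psource tE /=.
  by move=> pt; case: npq.
Qed.

End PathCompTheory.

Definition path_algebra (K : fieldType) (Q : quiver) := {malg K[qpath Q]}.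

Section PathAlgebra.
Variables (K : fieldType) (Q : quiver).
Local Notation KQ := (path_algebra K Q).
Implicit Types (f g h : KQ) (p q r : qpath Q) (c d : K).

HB.instance Definition _ := GRing.Lmodule.on KQ.

Definition path_elt p : KQ := << p >>.

Definition opath c (o : option (qpath Q)) : KQ :=
  if o is Some r then << c *g r >> else 0.

(* The bilinear extension of the composition of paths, where the product of
   two paths that are not composable is zero. *)
Fact pa_mul_key : unit. Proof. by []. Qed.

Definition pa_mul : KQ -> KQ -> KQ := locked_with pa_mul_key (fun f g =>
  \sum_(p <- msupp f) \sum_(q <- msupp g)
    opath (f@_p * g@_q) (path_comp p q)).

Lemma pa_mulE f g : pa_mul f g =
  \sum_(p <- msupp f) \sum_(q <- msupp g) opath (f@_p * g@_q) (path_comp p q).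
Proof. by rewrite /pa_mul unlock. Qed.

Definition pa_one : KQ := \sum_(a : vertex Q) path_elt (lazy_path a).

Lemma opathD c d o : opath (c + d) o = opath c o + opath d o.
Proof. by case: o => [r|] /=; rewrite ?addr0 // monalgUD. Qed.

Lemma opath0 o : opath 0 o = 0.
Proof. by case: o => [r|] //=; rewrite monalgU0. Qed.

Lemma opathZ c d o : c *: opath d o = opath (c * d) o.
Proof.
case: o => [r|] /=; last by rewrite scaler0.
by apply/malgP=> p; rewrite mcoeffZ 2!mcoeffU mulrnAr.
Qed.

Lemma pa_mulw (d1 d2 : {fset qpath Q}) f g :
    (msupp f `<=` d1)%fset -> (msupp g `<=` d2)%fset ->
  pa_mul f g = \sum_(p <- d1) \sum_(q <- d2) opath (f@_p * g@_q) (path_comp p q).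
Proof.
move=> le1 le2; rewrite pa_mulE (big_fset_incl _ le1) /=.
  apply/eq_bigr=> p _; apply/big_fset_incl => // q _ /mcoeff_outdom ->.
  by rewrite mulr0 opath0.
move=> p _ /mcoeff_outdom fp.
by rewrite big1 // => q _; rewrite fp mul0r opath0.
Qed.

Fact pa_mulDl : left_distributive pa_mul +%R.
Proof.
move=> f g h; set d := (msupp f `|` msupp g)%fset.
rewrite (@pa_mulw d (msupp h)) ?msuppD_le //.
rewrite (@pa_mulw d (msupp h) f) ?fsubsetUl //.
rewrite (@pa_mulw d (msupp h) g) ?fsubsetUr //.
rewrite -big_split; apply/eq_bigr => p _; rewrite -big_split.
by apply/eq_bigr => q _; rewrite mcoeffD mulrDl opathD.
Qed.

Fact pa_mulDr : right_distributive pa_mul +%R.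
Proof.
move=> h f g; set d := (msupp f `|` msupp g)%fset.
rewrite (@pa_mulw (msupp h) d) ?msuppD_le //.
rewrite (@pa_mulw (msupp h) d h f) ?fsubsetUl //.
rewrite (@pa_mulw (msupp h) d h g) ?fsubsetUr //.
rewrite -big_split; apply/eq_bigr => p _; rewrite -big_split.
by apply/eq_bigr => q _; rewrite mcoeffD mulrDr opathD.
Qed.

Lemma pa_mul0l g : pa_mul 0 g = 0.
Proof. by apply: (addrI (pa_mul 0 g)); rewrite -pa_mulDl !addr0. Qed.

Lemma pa_mul0r f : pa_mul f 0 = 0.
Proof. by apply: (addrI (pa_mul f 0)); rewrite -pa_mulDr !addr0. Qed.

Lemma pa_mul_suml (T : Type) (s : seq T) (F : T -> KQ) g :
  pa_mul (\sum_(i <- s) F i) g = \sum_(i <- s) pa_mul (F i) g.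
Proof.
exact: (big_morph (pa_mul^~ g) (fun x y => pa_mulDl x y g) (pa_mul0l g)).
Qed.

Lemma pa_mul_sumr (T : Type) (s : seq T) (F : T -> KQ) f :
  pa_mul f (\sum_(i <- s) F i) = \sum_(i <- s) pa_mul f (F i).
Proof. exact: (big_morph (pa_mul f) (pa_mulDr f) (pa_mul0r f)). Qed.

Lemma pa_mulUU c d p q :
  pa_mul << c *g p >> << d *g q >> = opath (c * d) (path_comp p q).
Proof.
rewrite (@pa_mulw [fset p]%fset [fset q]%fset) ?msuppU_le //.
by rewrite !big_seq_fset1 !mcoeffUU.
Qed.

Lemma malgU_ind (P : KQ -> Prop) :
    P 0 -> (forall f g, P f -> P g -> P (f + g)) ->
    (forall c p, P << c *g p >>) ->
  forall f, P f.
Proof.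
by move=> P0 PD PU f; rewrite [f]monalgE; apply: big_ind => // p _; apply: PU.
Qed.

Fact pa_mulA : associative pa_mul.
Proof.
elim/malgU_ind=> [g h|f1 f2 IH1 IH2 g h|c p].
- by rewrite !pa_mul0l.
- by rewrite 3!pa_mulDl IH1 IH2.
elim/malgU_ind=> [h|g1 g2 IH1 IH2 h|d q].
- by rewrite !(pa_mul0l, pa_mul0r).
- by rewrite pa_mulDl 2!pa_mulDr pa_mulDl IH1 IH2.
elim/malgU_ind=> [|h1 h2 IH1 IH2|e r].
- by rewrite !pa_mul0r.
- by rewrite 3!pa_mulDr IH1 IH2.
have := path_compA p q r; rewrite !pa_mulUU.
case: (path_comp p q) => [s|]; case: (path_comp q r) => [t|] //= E.
- by rewrite !pa_mulUU E mulrA.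
- by rewrite pa_mul0r pa_mulUU E.
- by rewrite pa_mul0l pa_mulUU -E.
- by rewrite pa_mul0l pa_mul0r.
Qed.

Fact pa_mul1l : left_id pa_one pa_mul.
Proof.
elim/malgU_ind=> [|f g IHf IHg|c p]; first exact: pa_mul0r.
  by rewrite pa_mulDr IHf IHg.
rewrite /pa_one pa_mul_suml (bigD1 (psource p)) //= big1 ?addr0.
  by rewrite pa_mulUU path_comp_lazyl eqxx mul1r.
by move=> a /negPf ne; rewrite pa_mulUU path_comp_lazyl ne.
Qed.

Fact pa_mul1r : right_id pa_one pa_mul.
Proof.
elim/malgU_ind=> [|f g IHf IHg|c p]; first exact: pa_mul0l.
  by rewrite pa_mulDl IHf IHg.
rewrite /pa_one pa_mul_sumr (bigD1 (ptarget p)) //= big1 ?addr0.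
  by rewrite pa_mulUU path_comp_lazyr eqxx mulr1.
by move=> a ne; rewrite pa_mulUU path_comp_lazyr eq_sym (negPf ne).
Qed.

HB.instance Definition _ := GRing.Zmodule_isPzRing.Build KQ
  pa_mulA pa_mul1l pa_mul1r pa_mulDl pa_mulDr.

Lemma path_eltM p q :
  path_elt p * path_elt q = oapp path_elt 0 (path_comp p q).
Proof.
by rewrite /path_elt [LHS]pa_mulUU mulr1; case: (path_comp p q).
Qed.

Lemma pa_scaleAl c f g : c *: (f * g) = (c *: f) * g.
Proof.
have le : (msupp (c *: f) `<=` msupp f)%fset by apply: msuppZ_le.
rewrite [RHS](pa_mulw le (fsubset_refl _)) -[f * g]/(pa_mul f g) pa_mulE scaler_sumr.
apply/eq_bigr => p _; rewrite scaler_sumr; apply/eq_bigr => q _.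
by rewrite opathZ mcoeffZ mulrA.
Qed.

Definition arrow_elt (x : arrow Q) : KQ := path_elt (arrow_path x).

Definition arrow_ideal : set KQ := ideal_generated (range arrow_elt).

Definition admissible (I : ideal KQ) :=
  (exists2 m, (2 <= m)%N & ideal_pow arrow_ideal m `<=` I) /\
  (I : set KQ) `<=` ideal_pow arrow_ideal 2.

End PathAlgebra.

(** * Bound quiver algebras *)

Section BoundQuiverAlgebra.
Variables (K : fieldType) (Q : quiver) (I : ideal (path_algebra K Q)).

Definition bound_quiver_algebra := quot_ring I.
Local Notation L := bound_quiver_algebra.

(* The paths of the bound quiver (Q, I) are the paths of Q outside I. *)
Definition is_bound_path (p : qpath Q) := ~ I (path_elt K p).

HB.instance Definition _ := GRing.PzRing.on L.

Definition bqa_scale (c : K) (x : L) : L := quot_class I (c *: repr x).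

Lemma bqa_scale_class c x :
  bqa_scale c (quot_class I x) = quot_class I (c *: x).
Proof.
have [_ _ IMl _] := idealP I.
have /quot_classP Iz := quot_classK (quot_class I x).
apply/quot_classP; rewrite -scalerBr -[X in _ *: X]mul1r pa_scaleAl.
exact: IMl.
Qed.

Fact bqa_scaleA a b x : bqa_scale a (bqa_scale b x) = bqa_scale (a * b) x.
Proof. by rewrite {2}/bqa_scale bqa_scale_class scalerA. Qed.

Fact bqa_scale1 : left_id 1 bqa_scale.
Proof. by move=> x; rewrite /bqa_scale scale1r quot_classK. Qed.

Fact bqa_scaleDr : right_distributive bqa_scale +%R.
Proof.
move=> a x y; rewrite -(quot_classK x) -(quot_classK y).
by rewrite -quot_classD !bqa_scale_class scalerDr quot_classD.
Qed.

Fact bqa_scaleDl x : {morph bqa_scale^~ x : a b / a + b}.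
Proof. by move=> a b; rewrite /bqa_scale scalerDl quot_classD. Qed.

HB.instance Definition _ := GRing.Zmodule_isLmodule.Build K L
  bqa_scaleA bqa_scale1 bqa_scaleDr bqa_scaleDl.

End BoundQuiverAlgebra.

(* Main.v *)
(* Under (i) and (iv) every indecomposable module [M] is generated by one vertex
   vector [m]: take a path [s] of maximal length with [m s <> 0].  At most one
   arrow ends at each vertex, so a functional [f] supported at the end of [s] and
   with [f (m s) = 1] yields an endomorphism
   [z |-> \sum_i f (z s_(i+1) ... s_n) m s_1 ... s_i], which retracts [M] onto the
   uniserial module spanned by the [m s_1 ... s_i].  By (iv) this only fails for
   [s] of length 1 starting at a vertex with two outgoing arrows, where [M] is the
   three-dimensional local module with socle of length 2.

   Conversely, each violation of (i), (ii) or (iv) provides an explicit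
   indecomposable module of length [l] with two incomparable submodules above
   [rad^(l - 2)]: the trees with arrows [0->1, 0->2, 0->3] (three arrows out of a
   vertex), [0->2, 1->2] (two arrows into a vertex), [0->1->3, 0->2] (a path of
   length 2 out of a vertex with two outgoing arrows) and
   [0->1, 1->3, 1->4, 2->3] (two continuations of an arrow). *)

(* A tree describes a module over the bound quiver algebra only if every element of [I] acts on it
   as zero, while [I] need not be generated by paths. For trees of height one admissibility is
   enough, since elements of [I] have no terms of length below 2. For trees containing a path of
   length 2, the bound on incoming arrows has to come first; it is proved with a tree of height one.
   It makes two paths of length at least 2 with a common target end in the same two arrows, and then
   every path of length 2 in the support of an element of [I] lies in [I].

   In the classification, indecomposability enters through one principle: an idempotent endomorphism
   fixing a nonzero vector is the identity. The fork is treated by the same principle as the chain,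
   with three functionals in place of a shifted family.

   Condition (iii) does not come from a tree. Once the other conditions are known, the
   classification applies to the given 2-factor serial module and exhibits the two arrows. *)
Require Import Defs.
From HB Require Import structures.
From mathcomp Require Import all_boot all_order all_algebra.
From mathcomp Require Import boolp classical_sets functions.
From mathcomp Require Import finmap.
From mathcomp.multinomials Require Import monalg.

Set Implicit Arguments.
Unset Strict Implicit.
Unset Printing Implicit Defensive.

Import GRing.Theory.
Local Open Scope ring_scope.

(** * Series of submodules *)

Section SubmoduleLattice.
Local Open Scope classical_set_scope.
Variables (R : pzRingType) (M : lmodType R).
Implicit Types (A B C L N P U V X : set M) (s t : seq (set M)).
Local Notation sub := (@is_submodule R M).
Local Notation cover := (@is_maximal_submodule R M).

Lemma submodD U x y : sub U -> U x -> U y -> U (x + y).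
Proof. by move=> [_ UD] Ux Uy; rewrite -[x]scale1r; apply: UD. Qed.

Lemma submodZ U a x : sub U -> U x -> U (a *: x).
Proof. by move=> [U0 UD] Ux; rewrite -[_ *: _]addr0; apply: UD. Qed.

Lemma submodN U x : sub U -> U x -> U (- x).
Proof. by move=> Us; rewrite -scaleN1r; apply: submodZ. Qed.

Lemma submodB U x y : sub U -> U x -> U y -> U (x - y).
Proof. by move=> Us Ux Uy; apply: submodD => //; apply: submodN. Qed.

Lemma submod_sum (J : Type) (r : seq J) (p : pred J) (F : J -> M) U :
  sub U -> (forall i, p i -> U (F i)) -> U (\sum_(i <- r | p i) F i).
Proof.
by move=> Us UF; apply: big_ind => //; [case: Us | move=> x y; apply: submodD].
Qed.

Lemma submod0 : sub [set 0].
Proof. by split=> // a x y /= -> ->; rewrite scaler0 addr0. Qed.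

Lemma submodI U V : sub U -> sub V -> sub (U `&` V).
Proof.
move=> [U0 UD] [V0 VD]; split=> // a x y [Ux Vx] [Uy Vy].
by split; [apply: UD | apply: VD].
Qed.

Definition submod_add U V : set M := [set x | exists u v, [/\ U u, V v & x = u + v]].

Lemma submod_addP U V : sub U -> sub V -> sub (submod_add U V).
Proof.
move=> Us Vs; split=> [|a _ _ [u [v [Uu Vv ->]]] [u' [v' [Uu' Vv' ->]]]].
  by exists 0, 0; rewrite addr0; case: Us Vs => [? _] [].
exists (a *: u + u'), (a *: v + v'); split.
- by case: Us => _; apply.
- by case: Vs => _; apply.
- by rewrite scalerDr addrACA.
Qed.

Lemma submod_addl U V : sub V -> U `<=` submod_add U V.
Proof. by move=> [V0 _] x Ux; exists x, 0; rewrite addr0. Qed.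

Lemma submod_addr U V : sub U -> V `<=` submod_add U V.
Proof. by move=> [U0 _] x Vx; exists 0, x; rewrite add0r. Qed.

Lemma submod_add_min U V L : sub L -> U `<=` L -> V `<=` L -> submod_add U V `<=` L.
Proof. by move=> Ls UL VL _ [u [v [/UL ? /VL ? ->]]]; apply: submodD. Qed.

Lemma coverP N U : cover N U ->
  [/\ sub N, N `<=` U, exists2 x, U x & ~ N x
    & forall L, sub L -> N `<=` L -> L `<=` U -> L = N \/ L = U].
Proof.
move=> [Ns [NU UN] max]; split=> //.
by apply: contrapT => no; apply: UN => x Ux; apply: contrapT => Nx; apply: no; exists x.
Qed.

Lemma coverI N U : sub N -> N `<=` U -> (exists2 x, U x & ~ N x) ->
  (forall L, sub L -> N `<=` L -> L `<=` U -> L = N \/ L = U) -> cover N U.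
Proof. by move=> ? ? [x Ux Nx] ?; split=> //; split=> // /(_ x Ux). Qed.

Lemma not_subset U V : ~ U `<=` V -> exists2 x, U x & ~ V x.
Proof.
move=> UV; apply: contrapT => no; apply: UV => x Ux.
by apply: contrapT => Vx; apply: no; exists x.
Qed.

(** Second isomorphism theorem: for [L] between the meet and [U], the sum [N + L] is [N] or [V], and
    the modular law recovers [L] in each case. *)
Lemma cover_meet U N V : sub U -> sub V -> cover N V -> U `<=` V ->
  ~ U `<=` N -> cover (U `&` N) U.
Proof.
move=> Us Vs /coverP[Ns NV _ max] UV UN.
apply: coverI => [|x []||L Ls IL LU] //; first exact: submodI.
  by have [x Ux Nx] := not_subset UN; exists x => // -[].
have [||E|E] := max _ (submod_addP Ns Ls).
- exact: submod_addl.
- by apply: submod_add_min => // x /LU/UV.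
- left; apply/seteqP; split=> // x Lx; split; first exact: LU.
  by rewrite -E; apply: submod_addr Lx; case: Ns.
right; apply/seteqP; split=> // x Ux.
have : V x by apply: UV.
rewrite -E => -[n [l [Nn Ll xE]]].
have nE : n = x - l by rewrite xE addrK.
rewrite xE; apply: submodD => //; apply: IL; split=> //.
by rewrite nE; apply: submodB => //; apply: LU.
Qed.

(** Dual of [cover_meet]: an intermediate [L] is tested by its meet with [B], which is [A] or
    [B]. *)
Lemma cover_join X A B : sub X -> sub B -> cover A B -> A `<=` X ->
  ~ B `<=` X -> cover X (submod_add X B).
Proof.
move=> Xs Bs /coverP[As AB _ max] AX BX.
have [b Bb Xb] := not_subset BX.
apply: coverI => [|||L Ls XL LXB] //.
- exact: submod_addl.
- by exists b => //; apply: submod_addr Bb; case: Xs.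
have [||E|E] := max _ (submodI Ls Bs).
- by move=> x Ax; split; [apply/XL/AX | apply: AB].
- by move=> x [].
- left; apply/seteqP; split=> // l Ll.
  have [x [c [Xx Bc lE]]] := LXB l Ll.
  have cE : c = l - x by rewrite lE addrC addKr.
  have : (L `&` B) c by split=> //; rewrite cE; apply: submodB => //; apply: XL.
  by rewrite E => /AX Xc; rewrite lE; apply: submodD.
right; apply/seteqP; split=> //; apply: submod_add_min => // x.
by rewrite -{1}E => -[].
Qed.

Lemma rad_set_cover N U : cover N U -> rad_set U `<=` N.
Proof. by move=> cN x [_]; apply. Qed.

(** A maximal submodule [N] of [V] either contains [U] or cuts out a maximal submodule of [U]; it
    contains [rad_set U] in both cases. *)
Lemma rad_set_sub U V : sub U -> sub V -> U `<=` V -> rad_set U `<=` rad_set V.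
Proof.
move=> Us Vs UV x [Ux rx]; split; first exact: UV.
move=> N cN; have [|UN] := pselect (U `<=` N); first exact.
by case: (rx _ (cover_meet Us Vs cN UV UN)).
Qed.

(* As in [composition_series], the bottom term [A] is left out of [s]. *)
Fixpoint series A s C : Prop :=
  if s is B :: s' then cover A B /\ series B s' C else A = C.

Lemma series_sub A s C : sub C -> series A s C -> sub A.
Proof. by case: s => [|B s] Cs /= => [->|[/coverP[]]]. Qed.

Lemma series_subset A s C : series A s C -> A `<=` C.
Proof.
elim: s A => [|B s IH] A /= => [-> //|[/coverP[_ AB _ _] /IH BC]] x /AB/BC //.
Qed.

Lemma series_cat A B C s t : series A s B -> series B t C -> series A (s ++ t) C.
Proof. by elim: s A => [|D s IH] A /= => [->|[cD /IH h] /h]. Qed.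

Lemma composition_seriesP s : composition_series s <-> series [set 0] s setT.
Proof.
rewrite /composition_series; move: [set 0] => A.
elim: s A => [|B s IH] A /=; first by split=> [[]|->].
split=> [[e cov]|[cB /IH[e cov]]].
  split; first exact: (cov 0%N).
  by apply/IH; split=> // i lis; apply: (cov i.+1).
by split=> // -[|i] //= /cov.
Qed.

(** No step collapses: since [D] lies in [X + P], an element [b = x + p] that is new in a term can
    be replaced by [x], which lies in [X] and is new as well. *)
Lemma series_meet P D X s : sub X -> sub D -> sub P -> series P s D ->
    D `<=` submod_add X P ->
  series (P `&` X) [seq B `&` X | B <- s] (D `&` X).
Proof.
move=> Xs Ds; elim: s P => [|B s IH] P Ps /= => [->//|[cB sB] DXP].
have Bs := series_sub Ds sB; have [_ PB [b Bb Pb] _] := coverP cB.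
split; last first.
  apply: IH => // z /DXP[x [p [Xx Pp ->]]].
  by exists x, p; split=> //; apply: PB.
have [x [p [Xx Pp bE]]] := DXP b (series_subset sB Bb).
have xE : x = b - p by rewrite bE addrK.
have -> : P `&` X = (B `&` X) `&` P.
  by apply/seteqP; split=> z [] => [Pz Xz|[Bz Xz] Pz] //; do 2?split=> //; apply: PB.
apply: (@cover_meet _ P B) => //; first exact: submodI.
move=> BXP; apply: Pb; rewrite bE; apply: submodD => //; apply: BXP.
by split=> //; rewrite xE; apply: submodB => //; apply: PB.
Qed.

(** If the first term [B] is not below [X], then it meets [X] in [A]. The series from [B] to [X + B]
    obtained by induction becomes one from [A] to [X] by meeting with [X], and the first step of [s]
    reappears as the cover of [X] by [X + B]. *)
Lemma series_split A s C X : sub C -> sub X -> series A s C ->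
    A `<=` X -> X `<=` C ->
  exists s1 s2, [/\ series A s1 X, series X s2 C & size s1 + size s2 = size s]%N.
Proof.
move=> Cs; elim: s A X => [|B s IH] A X Xs /= => [AC|[cB sB]] AX XC.
  by exists [::], [::]; split=> //=; rewrite AC in AX *; apply/seteqP; split.
have [As AB _ max] := coverP cB; have Bs := series_sub Cs sB.
have [BX|nBX] := pselect (B `<=` X).
  by have [s1 [s2 [h1 h2 <-]]] := IH B X Xs sB BX XC; exists (B :: s1), s2.
have E : B `&` X = A.
  have [|z []|->|E] // := max _ (submodI Bs Xs).
    by move=> z Az; split; [apply: AB|apply: AX].
  by case: nBX => z; rewrite -{1}E => -[].
have Bsub : B `<=` submod_add X B by apply: submod_addr; case: Xs.
have Xsub : X `<=` submod_add X B by apply: submod_addl.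
have XBs := submod_addP Xs Bs.
have XBC : submod_add X B `<=` C.
  by apply: submod_add_min => //; apply: series_subset sB.
have [s1 [s2 [h1 h2 <-]]] := IH _ _ XBs sB Bsub XBC.
exists [seq D `&` X | D <- s1], (submod_add X B :: s2); split.
- have := series_meet Xs XBs Bs h1 (@subset_refl _ _).
  by rewrite E (_ : _ `&` X = X) //; apply/seteqP; split=> [z []//|z Xz]; split=> //; apply: Xsub.
- by split=> //; apply: cover_join cB AX nBX.
- by rewrite size_map /= addnS.
Qed.

(** Splitting [s] at the first term [B] of [t] leaves a single step below [B], because [B] covers
    [A]; the parts above [B] are compared by induction. *)
Lemma Jordan_Hoelder A C s t : sub C -> series A s C -> series A t C ->
  size s = size t.
Proof.
move=> Cs; elim: t A s => [|B t IH] A s sA /=.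
  move=> AC; case: s sA => //= B s [/coverP[_ _ [x Bx Ax] _] /series_subset BC].
  by case: Ax; rewrite AC; apply: BC.
case=> cB tB; have Bs := series_sub Cs tB.
have [_ AB [x Bx Ax] max] := coverP cB.
have [s1 [s2 [h1 h2 <-]]] := series_split Cs Bs sA AB (series_subset tB).
rewrite (IH _ _ h2 tB) -add1n; congr addn.
case: s1 h1 => [/= E|D s1 /= [cD sD]]; first by rewrite E in Ax.
have [_ AD [y Dy Ay] _] := coverP cD.
have [|E|E] := max _ (series_sub Bs sD) AD; first exact: series_subset sD.
  by rewrite E in Dy.
case: s1 sD => //= F s1 [/coverP[_ _ [z Fz Dz] _] /series_subset FB].
by case: Dz; rewrite E; apply: FB.
Qed.

Definition total_submodules := forall U V, sub U -> sub V -> U `<=` V \/ V `<=` U.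

Lemma series_prefix A s1 t1 s2 t2 U V :
    series A s1 U -> series A t1 V -> s1 ++ s2 = t1 ++ t2 ->
  U `<=` V \/ V `<=` U.
Proof.
elim: s1 A t1 => [|B s1 IH] A [|D t1] /=.
- by move=> -> ->; left.
- by move=> -> [/coverP[_ AD _ _] /series_subset DV] _; left=> x /AD/DV.
- by move=> [/coverP[_ AD _ _] /series_subset DV] <- _; right=> x /AD/DV.
by move=> [_ sB] [_ sD] [BD]; rewrite -BD in sD *; apply: IH sB sD.
Qed.

Lemma series_total A s t C : sub C -> total_submodules -> series A s C ->
  series A t C -> s = t.
Proof.
move=> Cs tot; elim: s A t => [|B s IH] A [|D t] //=.
- by move=> -> [/coverP[_ _ [x Dx Cx] _] /series_subset/(_ _ Dx)].
- by move=> [/coverP[_ _ [x Bx Ax] _] /series_subset BC] eAC; case: Ax; rewrite eAC; apply: BC.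
move=> [cB sB] [cD sD].
have [Bs Ds] := (series_sub Cs sB, series_sub Cs sD).
suff BD : B = D by rewrite -BD in sD *; rewrite (IH _ _ sB sD).
have [_ AB [b Bb Ab] maxB] := coverP cB; have [_ AD [d Dd Ad] maxD] := coverP cD.
have [BD|DB] := tot _ _ Bs Ds.
  by have [E|//] := maxD _ Bs AB BD; rewrite E in Bb.
by have [E|//] := maxB _ Ds AD DB; rewrite E in Dd.
Qed.

Lemma sub_setT : sub setT. Proof. by []. Qed.

Lemma submod_ge0 U : sub U -> [set 0] `<=` U.
Proof. by move=> [U0 _] x ->. Qed.

(** Replaces uniqueness of the series by a condition that passes to quotients. Refining a
    composition series through [U] and through [V] gives twice the same series, in which both
    submodules occur. *)
Lemma uniserialP : uniserial M <->
  (exists s, composition_series s) /\ total_submodules.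
Proof.
split=> [[s [cs uniq]]|[[s cs] tot]].
  split=> [|U V Us Vs]; first by exists s.
  have /composition_seriesP ss := cs.
  have [s1 [s2 [h1 h2 _]]] := series_split sub_setT Us ss (submod_ge0 Us) (@subsetT _ _).
  have [t1 [t2 [g1 g2 _]]] := series_split sub_setT Vs ss (submod_ge0 Vs) (@subsetT _ _).
  apply: (series_prefix h1 g1 (etrans (esym (uniq (s1 ++ s2) _)) (uniq (t1 ++ t2) _))).
    exact/composition_seriesP/(series_cat h1 h2).
  exact/composition_seriesP/(series_cat g1 g2).
exists s; split=> // t /composition_seriesP ct.
by move/composition_seriesP: cs => cs; apply: series_total cs ct.
Qed.

End SubmoduleLattice.

(** * Submodules and series of a quotient module *)

Section QuotientLattice.
Local Open Scope classical_set_scope.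
Variables (R : pzRingType) (M : lmodType R) (X : submodule M).
Local Notation pr := (@quot_proj R M X).

Lemma quot_projZ a x : pr (a *: x) = a *: pr x.
Proof. exact/esym/quot_scale_proj. Qed.

Lemma quot_proj_image U : is_submodule U -> is_submodule (pr @` U).
Proof.
move=> [U0 UD]; split=> [|a _ _ [x Ux <-] [y Uy <-]].
  by exists 0 => //; have := quot_projZ 0 0; rewrite !scale0r.
by exists (a *: x + y); [apply: UD | rewrite quot_projD quot_projZ].
Qed.

Lemma quot_proj_preimage L : is_submodule L -> is_submodule (pr @^-1` L).
Proof.
move=> [L0 LD]; split=> [|a x y Lx Ly] /=.
  by have := quot_projZ 0 0; rewrite !scale0r => ->.
by rewrite quot_projD quot_projZ; apply: LD.
Qed.

Lemma quot_proj_surj y : exists x, pr x = y.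
Proof. by exists (repr y); apply: quot_projK. Qed.

Lemma quot_proj_imageP U x : is_submodule U -> X `<=` U -> (pr @` U) (pr x) <-> U x.
Proof.
move=> Us XU; split=> [[y Uy /quot_projP yx]|Ux]; last by exists x.
by rewrite -(subrK y x) -opprB; apply: submodD => //; apply: submodN => //; apply: XU.
Qed.

Lemma quot_preimageK L : pr @` (pr @^-1` L) = L.
Proof.
apply/seteqP; split=> [_ [x Lx <-] //|y Ly].
by have [x xy] := quot_proj_surj y; exists x => //=; rewrite xy.
Qed.

Lemma quot_preimage_ge L : is_submodule L -> X `<=` pr @^-1` L.
Proof.
move=> Ls x Xx /=; have -> : pr x = pr 0 by apply/quot_projP; rewrite subr0.
by have [] := quot_proj_preimage Ls.
Qed.

Lemma cover_quot U V : is_submodule V -> X `<=` U -> is_maximal_submodule U V ->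
  is_maximal_submodule (pr @` U) (pr @` V).
Proof.
move=> Vs XU /coverP[Us UV [x Vx Ux] max]; apply: coverI.
- exact: quot_proj_image.
- by move=> _ [y /UV Vy <-]; exists y.
- by exists (pr x); [exists x | move/(quot_proj_imageP _ Us XU)].
move=> L Ls UL LV; have [||E|E] := max _ (quot_proj_preimage Ls).
- by move=> y Uy; apply: UL; exists y.
- by move=> y /LV /(quot_proj_imageP _ Vs); apply=> z /XU/UV.
- by left; rewrite -E quot_preimageK.
- by right; rewrite -E quot_preimageK.
Qed.

Lemma series_quot U s V : is_submodule V -> X `<=` U -> series U s V ->
  series (pr @` U) [seq pr @` W | W <- s] (pr @` V).
Proof.
move=> Vs; elim: s U => [|B s IH] U XU /= => [-> //|[cB sB]].
have Bs := series_sub Vs sB; have [_ UB _ _] := coverP cB.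
split; first exact: cover_quot.
by apply: IH => // z /XU/UB.
Qed.

Lemma quot_composition_series s : series (X : set M) s setT ->
  composition_series [seq pr @` W | W <- s].
Proof.
move=> sX; apply/composition_seriesP.
have := @series_quot X s setT (@whole_submod _ _) (@subset_refl _ _) sX.
have -> : pr @` setT = setT.
  by apply/seteqP; split=> // y _; have [x <-] := quot_proj_surj y; exists x.
suff -> : pr @` X = [set 0] by [].
have pr0 : pr 0 = 0 by have := quot_projZ 0 0; rewrite !scale0r.
apply/seteqP; split=> [_ [x Xx <-]|_ ->] /=.
  by rewrite -pr0; apply/quot_projP; rewrite subr0.
by exists 0 => //; have [] := submodP X.
Qed.

Lemma quot_finite_length s : composition_series (M := M) s ->
  exists t, composition_series (M := quot_module X) t.
Proof.
move=> /composition_seriesP cs; have Xs := submodP X.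
have [s1 [s2 [_ h _]]] :=
  series_split (@whole_submod _ _) Xs cs (submod_ge0 Xs) (@subsetT _ _).
by exists [seq pr @` W | W <- s2]; apply: quot_composition_series.
Qed.

Lemma total_quot :
  (forall U V : set M, is_submodule U -> is_submodule V -> X `<=` U -> X `<=` V ->
    U `<=` V \/ V `<=` U) <-> total_submodules (quot_module X).
Proof.
split=> tot U V Us Vs.
  have [UV|VU] := tot _ _ (quot_proj_preimage Us) (quot_proj_preimage Vs)
    (quot_preimage_ge Us) (quot_preimage_ge Vs).
  - by left=> y; have [x <-] := quot_proj_surj y => /UV.
  - by right=> y; have [x <-] := quot_proj_surj y => /VU.
move=> XU XV; have [h|h] := tot _ _ (quot_proj_image Us) (quot_proj_image Vs).
- by left=> x Ux; apply/(quot_proj_imageP _ Vs XV); apply: h; exists x.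
- by right=> x Ux; apply/(quot_proj_imageP _ Us XU); apply: h; exists x.
Qed.

Lemma uniserial_quot : uniserial M -> uniserial (quot_module X).
Proof.
move=> /uniserialP[[s cs] tot]; apply/uniserialP; split.
  exact: quot_finite_length cs.
by apply/total_quot => U V Us Vs _ _; apply: tot.
Qed.

End QuotientLattice.

(** * Criteria for factor seriality and indecomposability *)

Section FactorSerialCriteria.
Local Open Scope classical_set_scope.
Variables (R : pzRingType) (M : lmodType R).

Lemma uniserial_not_two_factor_serial : uniserial M -> ~ two_factor_serial M.
Proof. by move=> uM [l [_ _ _]]; apply; apply: uniserial_quot. Qed.

Lemma has_length_uniq m n : has_length M m -> has_length M n -> m = n.
Proof.
move=> [s /composition_seriesP cs <-] [t /composition_seriesP ct <-].
exact: Jordan_Hoelder cs ct.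
Qed.

(** The length occurring in [two_factor_serial] must be [l] by Jordan-Hoelder, so one incomparable
    pair above [rad^(l - 2)] refutes both alternatives. *)
Lemma not_factor_serial l (U V : set M) : has_length M l -> (2 <= l)%N ->
    is_submodule U -> is_submodule V ->
    rad_pow M (l - 2) `<=` U -> rad_pow M (l - 2) `<=` V ->
    ~ U `<=` V -> ~ V `<=` U ->
  ~ (one_factor_serial M \/ two_factor_serial M).
Proof.
move=> lM l2 Us Vs rU rV UV VU [[_ /uniserialP[_ tot]]|].
  by case: (tot _ _ Us Vs).
move=> [k [/(has_length_uniq lM) <- _ /uniserialP[_ /total_quot tot] _]].
by case: (tot _ _ Us Vs rU rV).
Qed.

Lemma rad_powS_sub i : rad_pow M i.+1 `<=` rad_pow M i.
Proof. by move=> x []. Qed.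

Lemma rad_pow_sub1 i : rad_pow M i.+1 `<=` rad_pow M 1.
Proof. by elim: i => // i IH x /rad_powS_sub/IH. Qed.

Lemma rad_pow1_cover N : is_maximal_submodule N setT -> rad_pow M 1 `<=` N.
Proof. exact: rad_set_cover. Qed.

(** Here [rad M] lies in [W], hence [rad (rad M)] in [rad W] by monotonicity, hence in [N]. Thus the
    tree modules need no computation of radicals. *)
Lemma rad_pow2_cover N W : is_maximal_submodule W setT ->
  is_maximal_submodule N W -> rad_pow M 2 `<=` N.
Proof.
move=> cW cN; have [Ws _ _ _] := coverP cW.
move=> x r2; apply: (rad_set_cover cN); move: x r2.
apply: rad_set_sub => //; last exact: rad_pow1_cover.
exact: submodP.
Qed.

(** [N] is the largest proper submodule: two proper summands would both lie in it and could not add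
    up to [M]. *)
Lemma indecomposable_local (N : set M) : N <> setT ->
    (forall L, is_submodule L -> L = setT \/ L `<=` N) -> is_submodule N ->
  indecomposable M.
Proof.
move=> NT loc Ns; split.
  apply: contrapT => no; apply: NT; apply/seteqP; split=> // x _.
  have -> : x = 0 by apply: contrapT => x0; apply: no; exists x.
  by case: Ns.
move=> U V Us Vs UV dec; have [E|UN] := loc _ Us.
  right; apply/seteqP; split; last exact: submod_ge0.
  by rewrite -UV E setTI.
have [E|VN] := loc _ Vs.
  left; apply/seteqP; split; last exact: submod_ge0.
  by rewrite -UV E setIT.
case: NT; apply/seteqP; split=> // x _; have [u [v [Uu Vv ->]]] := dec x.
by apply: submodD; [|apply: UN|apply: VN].
Qed.

Lemma indecomposable_socle (w : M) : w <> 0 ->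
    (forall L, is_submodule L -> L = [set 0] \/ L w) -> indecomposable M.
Proof.
move=> w0 soc; split; first by exists w.
move=> U V Us Vs UV _; have [|Uw] := soc _ Us; first by left.
have [|Vw] := soc _ Vs; first by right.
by have : (U `&` V) w by []; rewrite UV.
Qed.

(** The series [0 < P < N < M] gives length 3. As [N] is the largest proper submodule, [rad M = N]
    and the top is simple; [rad^2 M] lies in both [P] and [Q], hence is 0, so the quotient by it
    still has the incomparable submodules [P] and [Q]. *)
Lemma two_factor_serial_diamond (P Q N : set M) :
    is_maximal_submodule [set 0] P -> is_maximal_submodule [set 0] Q ->
    is_maximal_submodule P N -> is_maximal_submodule Q N -> P <> Q ->
    is_maximal_submodule N setT ->
    (forall L, is_submodule L -> L = setT \/ L `<=` N) ->
  two_factor_serial M.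
Proof.
move=> c0P c0Q cPN cQN PQ cN loc.
have [Ps PN _ _] := coverP cPN; have [Qs QN _ _] := coverP cQN.
have [Ns _ [x _ Nx] max] := coverP cN.

have cs : composition_series [:: P; N; setT].
  apply/composition_seriesP; do 3?[split=> //].
have rad1 : rad_pow M 1 = N :> set M.
  apply/seteqP; split; first exact: rad_pow1_cover.
  move=> y Ny; split=> // L /coverP[Ls _ [z _ Lz] maxL].
  have [LT|LN] := loc _ Ls; first by case: Lz; rewrite LT.
  by have [<- //|NT] := maxL N Ns LN (@subsetT _ _); case: Nx; rewrite NT.
have PQ0 z : P z -> Q z -> z = 0.
  move=> Pz Qz; have [_ _ _ maxP] := coverP c0P.
  have [z' Pz' z'0] : exists2 z, P z & ~ [set 0] z by have [] := coverP c0P.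
  have [|y []|E|E] // := maxP _ (submodI Ps Qs).
  - exact: submod_ge0 (submodI Ps Qs).
  - by have : (P `&` Q) z by []; rewrite E.
  have PsQ : P `<=` Q by move=> y; rewrite -{1}E => -[].
  have [_ _ _ maxQ] := coverP c0Q.
  by have [EP|//] := maxQ _ Ps (submod_ge0 Ps) PsQ; rewrite EP in Pz'.
have rad2 z : rad_pow M 2 z -> z = 0.
  move=> r; apply: PQ0; first exact: (rad_pow2_cover cN cPN).
  exact: (rad_pow2_cover cN cQN).
exists 3; split=> //; first by exists [:: P; N; setT].
  apply/uniserialP; split; first exact: quot_finite_length cs.
  apply/total_quot => U V Us Vs; rewrite !rad1 => NU NV.
  have [->|E] := max _ Us NU (@subsetT _ _); first by left.
  by rewrite E; right.
move=> /uniserialP[_ /total_quot tot].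
have r2 U : is_submodule U -> rad_pow M 2 `<=` U by move=> [U0 _] z /rad2->.

have [_ _ [x1 Px1 x10] _] := coverP c0P; have [_ _ [x2 Qx2 x20] _] := coverP c0Q.
have [PsQ|QsP] := tot _ _ Ps Qs (r2 _ Ps) (r2 _ Qs).
  by case: x10; apply: PQ0 Px1 (PsQ _ Px1).
by case: x20; apply: PQ0 (QsP _ Qx2) Qx2.
Qed.

End FactorSerialCriteria.

(** * Scalars from a field *)

Section ScalarsFromField.
Local Open Scope classical_set_scope.
Variables (K : fieldType) (A : pzRingType) (io : {rmorphism K -> A}).
Variable M : lmodType A.
Implicit Types (U H : set M) (c d : K) (x y z v : M).

Definition scalar_closed H := H 0 /\ forall c x y, H x -> H y -> H (io c *: x + y).

Lemma scalar_closedP U : is_submodule U -> scalar_closed U.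
Proof. by move=> [U0 UD]; split=> // c; apply: UD. Qed.

Lemma scalar_closedZ H c x : scalar_closed H -> H x -> H (io c *: x).
Proof. by move=> [H0 HD] Hx; rewrite -[_ *: _]addr0; apply: HD. Qed.

Lemma scalar_closedD H x y : scalar_closed H -> H x -> H y -> H (x + y).
Proof. by move=> [_ HD] Hx Hy; rewrite -[x]scale1r -(rmorph1 io); apply: HD. Qed.

Lemma scalar_closedN H x : scalar_closed H -> H x -> H (- x).
Proof. by move=> Hs /(scalar_closedZ (-1) Hs); rewrite rmorphN1 scaleN1r. Qed.

Lemma scalar_closedB H x y : scalar_closed H -> H x -> H y -> H (x - y).
Proof. by move=> Hs Hx Hy; apply: scalar_closedD => //; apply: scalar_closedN. Qed.

Lemma scalarK c x : c != 0 -> io c^-1 *: (io c *: x) = x.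
Proof. by move=> c0; rewrite scalerA -rmorphM mulVf // rmorph1 scale1r. Qed.

Lemma scalar_closed_cancel H c x : scalar_closed H -> c != 0 -> H (io c *: x) -> H x.
Proof. by move=> Hs c0 /(scalar_closedZ c^-1 Hs); rewrite scalarK. Qed.

Lemma scalar_eq0 c x : io c *: x = 0 -> x <> 0 -> c = 0.
Proof.
move=> cx x0; have [//|c0] := eqVneq c 0.
by case: x0; rewrite -(scalarK x c0) cx scaler0.
Qed.

(** [U] has codimension one over [K]: an element of [L] outside [U] is a nonzero multiple of [v]
    modulo [U], so [L] contains [v]. *)
Lemma cover_codim1 U (T : set M) v : is_submodule U -> U `<=` T -> T v -> ~ U v ->
  (forall t, T t -> exists c, U (t - io c *: v)) -> is_maximal_submodule U T.
Proof.
move=> Us UT Tv Uv dec; apply: coverI => [//|//||L Ls UL LT]; first by exists v.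
have [LU|/not_subset[l Ll Ul]] := pselect (L `<=` U).
  by left; apply/seteqP.
right; apply/seteqP; split=> // t Tt.
have [c Uc] := dec l (LT l Ll); have [d Ud] := dec t Tt.
have c0 : c != 0.
  by apply: contra_notN Ul => /eqP c0; move: Uc; rewrite c0 rmorph0 scale0r subr0.
have Lv : L v.
  apply: (scalar_closed_cancel (scalar_closedP Ls) c0).
  by rewrite -[_ *: _](subKr l); apply: submodB => //; apply: UL.
by rewrite -[t](subrK (io d *: v)); apply: submodD => //; [apply: UL | apply: submodZ].
Qed.

Definition scalar_spanned :=
  exists (J : finType) (g : J -> M), forall z, exists c : J -> K, z = \sum_i io (c i) *: g i.

Lemma scalar_spanned_fg : (exists (n : nat) (g : 'I_n -> A),
    forall a, exists c : 'I_n -> K, a = \sum_i io (c i) * g i) ->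
  finitely_generated M -> scalar_spanned.
Proof.
move=> [n [g gen]] [k [h genM]].
exists ('I_k * 'I_n)%type, (fun ij => g ij.2 *: h ij.1) => z.
have [a ->] := genM z.
have /choice[d dE] : forall i, exists d : 'I_n -> K, a i = \sum_j io (d j) * g j.
  by move=> i; apply: gen.
exists (fun ij => d ij.1 ij.2).
rewrite -(pair_bigA _ (fun i j => io (d i j) *: (g j *: h i))) /=.
apply: eq_bigr => i _; rewrite dE scaler_suml; apply: eq_bigr => j _.
by rewrite scalerA.
Qed.

(** The generators are treated one at a time: one that lies in [H' + K v] is left alone, any other
    is added to [H'], which keeps [v] outside. The final [H'] is a complement of the line [K v]. *)
Lemma separation_hyperplane (H : set M) v : scalar_spanned -> scalar_closed H -> ~ H v ->
  exists2 H' : set M, scalar_closed H' /\ H `<=` H' &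
    ~ H' v /\ forall z, exists c, H' (z - io c *: v).
Proof.
move=> [J [g gen]] Hs Hv.
have [H' [[H's HH'] H'v dec]] : exists H', [/\ scalar_closed H' /\ H `<=` H', ~ H' v &
    forall i, i \in enum J -> exists c, H' (g i - io c *: v)].
  elim: (enum J) => [|i s [H' [[H's HH'] H'v dec]]]; first by exists H; split=> [|//|i]; [split|rewrite in_nil].
  have [[c Hc]|no] := pselect (exists c, H' (g i - io c *: v)).
    exists H'; split=> // j; rewrite inE => /predU1P[->|/dec //]; by exists c.
  exists [set z | exists c h, H' h /\ z = h + io c *: g i]; split.
  - split=> [|z Hz]; last by exists 0, z; rewrite rmorph0 scale0r addr0; split=> //; apply: HH'.
    split=> [|c x y [c1 [h1 [H1 ->]]] [c2 [h2 [H2 ->]]]].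
      by exists 0, 0; rewrite rmorph0 scale0r addr0; case: H's.
    exists (c * c1 + c2), (io c *: h1 + h2); split; first by case: H's => _; apply.
    by rewrite scalerDr rmorphD rmorphM scalerDl scalerA addrACA.
  - move=> [c [h [Hh vE]]]; have [c0|c0] := eqVneq c 0.
      by apply: H'v; rewrite vE c0 rmorph0 scale0r addr0.
    apply: no; exists c^-1; rewrite vE scalerDr scalarK // opprD addrC addrNK.
    by apply: scalar_closedN => //; apply: scalar_closedZ.
  - move=> j; rewrite inE => /predU1P[->|/dec[c Hc]].
      by exists 0, 1, 0; rewrite rmorph0 scale0r rmorph1 scale1r subr0 add0r; case: H's.
    by exists c, 0, (g j - io c *: v); rewrite rmorph0 scale0r addr0.
exists H' => //; split=> // z; have [c ->] := gen z.
have /choice[d dP] : forall i, exists d, H' (g i - io d *: v).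
  by move=> i; apply: dec; rewrite mem_enum.
exists (\sum_i c i * d i); rewrite rmorph_sum scaler_suml -sumrB.
apply: big_ind => [|x y|i _]; first by case: H's.
  exact: scalar_closedD.
by rewrite rmorphM -scalerA -scalerBr; apply: scalar_closedZ.
Qed.

(** [f z] is the multiple of [v] by which [z] differs from the hyperplane; it is unique because [v]
    is not in the hyperplane. *)
Lemma separating_functional (H : set M) v : scalar_spanned -> scalar_closed H -> ~ H v ->
  exists f : M -> K, [/\ forall x y, f (x + y) = f x + f y,
    forall c x, f (io c *: x) = c * f x, forall h, H h -> f h = 0 & f v = 1].
Proof.
move=> sp Hs Hv; have [H' [H's HH'] [H'v /choice[f fP]]] := separation_hyperplane sp Hs Hv.
have funiq z c : H' (z - io c *: v) -> f z = c.
  move=> zc; apply/eqP; rewrite -subr_eq0; apply/eqP.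
  have [//|nz] := eqVneq (f z - c) 0.
  case: H'v; apply: (scalar_closed_cancel H's nz).
  rewrite rmorphB scalerBl (_ : _ - _ = (z - io c *: v) - (z - io (f z) *: v)).
    exact: scalar_closedB.
  by rewrite opprB [RHS]addrC addrA subrK.
exists f; split=> [x y|c x|h Hh|]; apply: funiq.
- by rewrite rmorphD scalerDl opprD addrACA; apply: scalar_closedD.
- by rewrite rmorphM -scalerA -scalerBr; apply: scalar_closedZ.
- by rewrite rmorph0 scale0r subr0; apply: HH'.
- by rewrite rmorph1 scale1r subrr; case: H's.
Qed.

End ScalarsFromField.

(** * Modules over the algebra of a quiver *)

(* Right modules over a path algebra are left modules over [A], its converse
   ring, so [X x * g] stands for [g] followed by the arrow [x]. *)
Record quiver_generated (K : fieldType) (Q : quiver) (A : pzRingType)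
    (io : {rmorphism K -> A}) (E : vertex Q -> A) (X : arrow Q -> A) : Prop := {
  qg_central : forall c a, io c * a = a * io c;
  qg_sum : \sum_a E a = 1;
  qg_idemM : forall a b, E b * E a = if a == b then E a else 0;
  qg_arr_src : forall x, X x * E (src x) = X x;
  qg_arr_tgt : forall x, E (tgt x) * X x = X x;
  qg_ind : forall P : A -> Prop, P 0 -> (forall a b, P a -> P b -> P (a + b)) ->
    (forall c a, P a -> P (io c * a)) -> (forall a, P (E a)) ->
    (forall x a, P a -> P (X x * a)) -> forall a, P a }.

Section QuiverModules.
Local Open Scope classical_set_scope.
Variables (K : fieldType) (Q : quiver) (A : pzRingType).
Variables (io : {rmorphism K -> A}) (E : vertex Q -> A) (X : arrow Q -> A).
Hypothesis qg : quiver_generated io E X.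
Implicit Types (a b c : vertex Q) (x y : arrow Q) (s t u : seq (arrow Q)).

Lemma arr_idem x a : X x * E a = if src x == a then X x else 0.
Proof.
rewrite -(qg_arr_src qg) -mulrA (qg_idemM qg) eq_sym.
by case: eqP => [->|_]; rewrite ?mulr0 ?(qg_arr_src qg).
Qed.

Lemma idem_arr x a : E a * X x = if tgt x == a then X x else 0.
Proof.
rewrite -(qg_arr_tgt qg) mulrA (qg_idemM qg).
by case: eqP => [_|_]; rewrite ?mul0r ?(qg_arr_tgt qg).
Qed.

(** New factors go to the left because [A] is the converse ring: acting by [wprod s] traverses [s]
    from its first arrow. *)
Definition wprod s : A := foldl (fun g x => X x * g) 1 s.

Section Module.
Variable M : lmodType A.
Implicit Types z m : M.

Lemma submodule_gen (U : set M) : U 0 -> (forall z w, U z -> U w -> U (z + w)) ->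
  (forall d z, U z -> U (io d *: z)) -> (forall a z, U z -> U (E a *: z)) ->
  (forall x z, U z -> U (X x *: z)) -> is_submodule U.
Proof.
move=> U0 UD Uio UE UX; split=> // a z w Uz Uw; apply: (UD) => // {w Uw}.
elim/(qg_ind qg): a z Uz => [z _|a b IHa IHb z Uz|d a IH z Uz|a z Uz|x a IH z Uz].
- by rewrite scale0r.
- by rewrite scalerDl; apply: UD; [apply: IHa | apply: IHb].
- by rewrite -scalerA; apply/Uio/IH.
- exact: UE.
- by rewrite -scalerA; apply/UX/IH.
Qed.

Lemma linear_gen (r : M -> M) : (forall z w, r (z + w) = r z + r w) ->
  (forall d z, r (io d *: z) = io d *: r z) -> (forall a z, r (E a *: z) = E a *: r z) ->
  (forall x z, r (X x *: z) = X x *: r z) -> forall (g : A) z, r (g *: z) = g *: r z.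
Proof.
move=> rD rio rE rX.
have r0 : r 0 = 0 by apply: (addrI (r 0)); rewrite -rD !addr0.
elim/(qg_ind qg) => [z|a b IHa IHb z|d a IH z|a z|x a IH z] //.
- by rewrite !scale0r.
- by rewrite !scalerDl rD IHa IHb.
- by rewrite -!scalerA rio IH.
- by rewrite -!scalerA rX IH.
Qed.

Definition wact s z := foldl (fun z x => X x *: z) z s.

Lemma wact_cat s t z : wact (s ++ t) z = wact t (wact s z).
Proof. exact: foldl_cat. Qed.

Lemma wact_rcons s x z : wact (rcons s x) z = X x *: wact s z.
Proof. by rewrite -cats1 wact_cat. Qed.

Lemma wactD s z w : wact s (z + w) = wact s z + wact s w.
Proof. by elim/last_ind: s => // s x IH; rewrite !wact_rcons IH scalerDr. Qed.

Lemma wactZ s d z : wact s (io d *: z) = io d *: wact s z.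
Proof.
by elim/last_ind: s => // s x IH; rewrite !wact_rcons IH !scalerA (qg_central qg).
Qed.

Lemma wact0 s : wact s 0 = 0.
Proof. by elim: s => //= x s IH; rewrite scaler0. Qed.

Lemma wact_sum s (J : Type) (r : seq J) (p : pred J) (F : J -> M) :
  wact s (\sum_(i <- r | p i) F i) = \sum_(i <- r | p i) wact s (F i).
Proof. by apply: big_morph; [apply: wactD | apply: wact0]. Qed.

Lemma scalar_swap (g : A) d z : g *: (io d *: z) = io d *: (g *: z).
Proof. by rewrite !scalerA (qg_central qg). Qed.

Lemma wact_wprod s z : wact s z = wprod s *: z.
Proof.
rewrite /wprod -{1}[z]scale1r; move: 1 => g.
by elim: s g => //= x s IH g; rewrite scalerA IH.
Qed.

Lemma wact_neq0 s z : wact s z <> 0 -> wprod s <> 0.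
Proof. by rewrite wact_wprod => + w0; rewrite w0 scale0r. Qed.

(** An empty word carries no vertex, so each end is computed with the opposite end as default. *)
Definition wend a s := last a (map (@tgt Q) s).
Definition wstart s b := head b (map (@src Q) s).

Lemma idem_wact b a s m : E a *: m = m ->
  E b *: wact s m = if b == wend a s then wact s m else 0.
Proof.
move=> am; elim/last_ind: s => [|s x _].
  by rewrite /wend /= -am scalerA (qg_idemM qg) eq_sym; case: eqP; rewrite ?scale0r.
rewrite /wend map_rcons last_rcons wact_rcons scalerA idem_arr eq_sym.
by case: eqP; rewrite ?scale0r.
Qed.

Lemma wact_idem b a s z :
  E b *: wact s (E a *: z) = if a == wstart s b then E b *: wact s z else 0.
Proof.
case: s => [|x s]; rewrite /wstart /= scalerA.
  by rewrite (qg_idemM qg); case: eqP => [->|]; rewrite ?scale0r.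
by rewrite arr_idem eq_sym; case: eqP; rewrite // scale0r wact0 scaler0.
Qed.

Lemma wact_arr b x s z : tgt x != wstart s b -> E b *: wact s (X x *: z) = 0.
Proof.
by move=> ne; rewrite -(qg_arr_tgt qg) -scalerA wact_idem (negPf ne).
Qed.

Lemma idem_decomp z : z = \sum_a E a *: z.
Proof. by rewrite -scaler_suml (qg_sum qg) scale1r. Qed.

Lemma wact_cons_src a m x s : E a *: m = m -> wact (x :: s) m <> 0 -> src x = a.
Proof.
move=> am; rewrite /= -am scalerA arr_idem; case: eqP => // _.
by rewrite scale0r wact0.
Qed.

(** [M] is the direct sum of the range and the kernel of the idempotent [r]; the range contains [m],
    so the kernel is 0. *)
Lemma retraction_id (r : M -> M) m : indecomposable M ->
  (forall z w, r (z + w) = r z + r w) -> (forall (g : A) z, r (g *: z) = g *: r z) ->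
  (forall z, r (r z) = r z) -> m <> 0 -> r m = m -> forall z, r z = z.
Proof.
move=> [_ ind] rD rZ rr m0 rm z.
have r0 : r 0 = 0 by have := rZ 0 0; rewrite !scale0r.
have rB w : r (w - r w) = 0 by rewrite rD -scaleN1r rZ rr scaleN1r subrr.
have [||||E0|E0] := ind (range r) [set z | r z = 0].
- by split=> [|a _ _ [z1 _ <-] [z2 _ <-]]; [exists 0 | exists (a *: z1 + z2); rewrite ?rD ?rZ].
- by split=> //= a z1 z2 e1 e2; rewrite rD rZ e1 e2 scaler0 addr0.
- apply/seteqP; split=> [_ [[w _ <-] /=]|_ ->]; first by rewrite rr.
  by split=> //; exists 0.
- by move=> w; exists (r w), (w - r w); split=> //=; [exists w | rewrite addrC subrK].
- have: (range r) m by exists m.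
  by rewrite E0 => /m0.
- have : [set z | r z = 0] (z - r z) by apply: rB.
  by rewrite E0 /= => /eqP; rewrite subr_eq0 => /eqP.
Qed.

End Module.
End QuiverModules.

(** * Chain and fork modules *)

Section ChainModules.
Local Open Scope classical_set_scope.
Variables (K : fieldType) (Q : quiver) (A : pzRingType).
Variables (io : {rmorphism K -> A}) (E : vertex Q -> A) (X : arrow Q -> A).
Hypothesis qg : quiver_generated io E X.
Variables (M : lmodType A) (m : M) (a : vertex Q) (s : seq (arrow Q)).
Implicit Types (z : M) (x : arrow Q) (t u : seq (arrow Q)).
Local Notation wact := (wact X).
Local Notation n := (size s).
Local Notation b := (wend a s).
Local Notation xx i := (wact (take i s) m).
Hypothesis m_idem : E a *: m = m.
Hypothesis m_top : wact s m <> 0.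
Hypothesis long0 : forall t z, (n < size t)%N -> wact t z = 0.
Hypothesis m_chain : forall t, (size t <= n)%N -> wact t m <> 0 -> t = take (size t) s.

Lemma idem_m c t : E c *: wact t m = if c == wend a t then wact t m else 0.
Proof. exact: (idem_wact qg). Qed.

Lemma xx_last : xx n = wact s m. Proof. by rewrite take_size. Qed.

Lemma xx_drop i : (i <= n)%N -> wact (drop i s) (xx i) = wact s m.
Proof. by move=> _; rewrite -wact_cat cat_take_drop. Qed.

Lemma wact_xx i t : (i <= n)%N -> wact t (xx i) <> 0 ->
  (i + size t <= n)%N /\ wact t (xx i) = xx (i + size t)%N.
Proof.
move=> lin; rewrite -wact_cat => nz.
have sz : size (take i s ++ t) = (i + size t)%N by rewrite size_cat size_takel.
have le : (i + size t <= n)%N.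
  by rewrite leqNgt; apply/negP => lt; apply: nz; apply: long0; rewrite sz.
by split=> //; rewrite -sz -m_chain // sz.
Qed.

(** Reads off a leading coefficient: later vectors are pushed beyond length [n], hence to 0, and
    only [xx i] reaches the top. *)
Lemma wact_drop_comb (c : nat -> K) i : (i <= n)%N -> (forall j, (j < i)%N -> c j = 0) ->
  wact (drop i s) (\sum_(j < n.+1) io (c j) *: xx j) = io (c i) *: wact s m.
Proof.
move=> lin c0; rewrite wact_sum (bigD1 (Ordinal (lin : (i < n.+1)%N))) //=.
rewrite (wactZ qg) xx_drop // big1 ?addr0 // => j ji.
rewrite (wactZ qg); have [lt|gt|eq] := ltngtP j i.
- by rewrite c0 // rmorph0 scale0r.
- rewrite -wact_cat long0 ?scaler0 // size_cat size_takel; last by rewrite -ltnS.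
  by rewrite size_drop addnBA // ltn_subRL ltn_add2r.
- by case/eqP: ji; apply: val_inj.
Qed.

Definition span_below z := exists c : nat -> K, z = \sum_(j < n) io (c j) *: xx j.

Lemma span_below_closed : scalar_closed io span_below.
Proof.
split=> [|d _ _ [c1 ->] [c2 ->]].
  by exists (fun=> 0); rewrite big1 // => i _; rewrite rmorph0 scale0r.
exists (fun j => d * c1 j + c2 j); rewrite scaler_sumr -big_split.
by apply: eq_bigr => j _; rewrite rmorphD rmorphM scalerDl scalerA.
Qed.

Lemma span_below_top : ~ span_below (wact s m).
Proof.
move=> [c cE].
(* The value -1 at [n] turns the supposed equation into a linear relation among all the [xx j]. Its
   coefficients vanish successively, which is absurd at [n]. *)
pose d j := if (j < n)%N then c j else -1.
have dE : \sum_(j < n.+1) io (d j) *: xx j = 0.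
  rewrite big_ord_recr /= {2}/d ltnn rmorphN1 scaleN1r xx_last cE.
  by apply/eqP; rewrite subr_eq0; apply/eqP/eq_bigr => j _; rewrite /d ltn_ord.
have d0 j : (j <= n)%N -> d j = 0.
  elim/ltn_ind: j => j IH ljn.
  apply: (scalar_eq0 (io := io) _ m_top).
  rewrite -(wact_drop_comb ljn) ?dE ?wact0 // => i ij.
  by apply: IH => //; apply: leq_trans ljn; apply: ltnW.
by have := d0 n (leqnn n); rewrite /d ltnn => /eqP; rewrite oppr_eq0 oner_eq0.
Qed.

Lemma chain_span : indecomposable M -> scalar_spanned io M ->
  (forall x y : arrow Q, tgt x = tgt y -> x = y) ->
  forall z, exists c : nat -> K, z = \sum_(j < n.+1) io (c j) *: xx j.
Proof.
move=> ind sp hin.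
have [f0 [f0D f0Z f0H f01]] := separating_functional sp span_below_closed span_below_top.
(* Composing with [E b] concentrates the functional at the end vertex of [s]; this makes [r] below
   commute with vertices and arrows. *)
pose f z := f0 (E b *: z).
have fD z w : f (z + w) = f z + f w by rewrite /f scalerDr f0D.
have fZ c z : f (io c *: z) = c * f z by rewrite /f (scalar_swap qg) f0Z.
have f0_0 : f0 0 = 0 by rewrite f0H //; case: span_below_closed.
have fxx i : (i < n)%N -> f (xx i) = 0.
  move=> lin; rewrite /f idem_m; case: ifP => // _; rewrite f0H //.
  exists (fun j => (j == i)%:R).
  rewrite (bigD1 (Ordinal lin)) //= eqxx rmorph1 scale1r big1 ?addr0 // => j.
  by rewrite -val_eqE /= => /negPf->; rewrite rmorph0 scale0r.
have ftop : f (wact s m) = 1 by rewrite /f idem_m eqxx.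
have f_0 : f 0 = 0 by rewrite /f scaler0.
pose g i z := f (wact (drop i s) z).
pose r z := \sum_(j < n.+1) io (g j z) *: xx j.
have gD i z w : g i (z + w) = g i z + g i w by rewrite /g wactD fD.
have gZ i c z : g i (io c *: z) = c * g i z by rewrite /g (wactZ qg) fZ.
(* The initial part of [s] ends where the rest begins, for otherwise [wact s m] would vanish. *)
have start_drop i : (i <= n)%N -> wend a (take i s) = wstart (drop i s) b.
  move=> lin; apply/eqP; apply: contra_notT m_top => ne.
  have /(congr1 (fun z => E b *: wact (drop i s) z)) := idem_m (wend a (take i s)) (take i s).
  rewrite eqxx (wact_idem qg) (negPf ne) xx_drop // idem_m eqxx.
  by move=> <-.
have rD z w : r (z + w) = r z + r w.
  rewrite -big_split; apply: eq_bigr => j _ /=.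
  by rewrite gD rmorphD scalerDl.
have rZ c z : r (io c *: z) = io c *: r z.
  by rewrite scaler_sumr; apply: eq_bigr => j _; rewrite gZ rmorphM scalerA.
have rE c z : r (E c *: z) = E c *: r z.
  rewrite scaler_sumr; apply: eq_bigr => j _.
  have ljn : (j <= n)%N by rewrite -ltnS.
  rewrite (scalar_swap qg) idem_m start_drop // /g /f (wact_idem qg).
  by case: ifP => // _; rewrite f0_0 rmorph0 scale0r scaler0.
(* Acting by [x] shifts the index by one, and the term lost at either end involves a word of length
   [n + 1]. In the other terms, if [x] is not the next arrow of [s], the right side vanishes by
   [m_chain], and the left side because the arrow of [s] is the only one ending at the start of
   [drop i.+1 s]. *)
have rX x z : r (X x *: z) = X x *: r z.
  rewrite /r big_ord_recl big_ord_recr /= scalerDr scaler_sumr /g !drop0.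
  rewrite -[wact s _]/(wact (x :: s) z) long0 // f_0 rmorph0 scale0r add0r.
  rewrite (scalar_swap qg) -wact_rcons (long0 (t := rcons _ _)); last first.
    by rewrite size_rcons size_takel.
  rewrite scaler0 addr0; apply: eq_bigr => i _; rewrite /bump /= add1n.
  have lin := ltn_ord i.
  rewrite (scalar_swap qg) -wact_rcons.
  have [<-|ne] := eqVneq (nth x s i) x.
    by rewrite -take_nth // -[wact (drop i.+1 s) _]/(wact (_ :: drop i.+1 s) _) -drop_nth.
  rewrite [in RHS](_ : wact _ m = 0) ?scaler0; last first.
    apply: contrapT => /m_chain; rewrite size_rcons (size_takel (ltnW lin)) => /(_ lin).
    by rewrite (take_nth x) // => /rcons_inj[] /esym/eqP; rewrite (negPf ne).
  rewrite [f _](_ : _ = 0) ?rmorph0 ?scale0r // /f (wact_arr qg) ?f0_0 //.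
  apply: contraNneq ne => tx; apply/eqP/hin; rewrite tx.
  apply/eqP; apply: contra_notT m_top => ne.
  have := wact_arr qg (b := b) (xx i) ne.
  rewrite -[wact _ (X _ *: _)]/(wact (_ :: drop i.+1 s) _) -drop_nth // (xx_drop (ltnW lin)).
  by rewrite idem_m eqxx.
(* All coefficients but the first vanish: a nonzero [wact (drop i.+1 s) m] is an [xx j] with
   [j < n], where [f] is 0. *)
have rm : r m = m.
  rewrite /r big_ord_recl big1 /=; last first.
    move=> i _; rewrite /bump add1n /g.
    have [->|nz] := pselect (wact (drop i.+1 s) m = 0).
      by rewrite f_0 rmorph0 scale0r.
    have lt : (size (drop i.+1 s) < n)%N by rewrite size_drop subnSK ?leq_subr.
    by rewrite (m_chain (ltnW lt) nz) (fxx _ lt) rmorph0 scale0r.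
  by rewrite addr0 /g drop0 take0 ftop rmorph1 scale1r.
have rlin := linear_gen qg rD rZ rE rX.
have r0 : r 0 = 0 by have := rZ 0 0; rewrite rmorph0 !scale0r.
have rxx t : r (wact t m) = wact t m.
  by elim/last_ind: t => // t x IH; rewrite !wact_rcons rX IH.
have rr z : r (r z) = r z.
  rewrite {2}/r (big_morph r rD r0); apply: eq_bigr => j _.
  by rewrite rZ rxx.
have m0 : m <> 0 by move=> m0; apply: m_top; rewrite m0 wact0.
by move=> z; exists (g^~ z); rewrite -[LHS](retraction_id ind rD rlin rr m0 rm).
Qed.

(** The socle series of [M]; for a chain its terms turn out to be all the submodules. *)
Definition killed_by_length k : set M := [set z | forall t, size t = k -> wact t z = 0].
Local Notation S := killed_by_length.

Lemma killed_by_length_le k l : (k <= l)%N -> S k `<=` S l.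
Proof.
move=> kl z Sz t tl; rewrite -(cat_take_drop k t) wact_cat Sz ?wact0 //.
by rewrite size_takel // tl.
Qed.

Lemma killed_by_length_submodule k : is_submodule (S k).
Proof.
apply: (submodule_gen qg) => [t _|z w Sz Sw t tk|d z Sz t tk|c z Sz t tk|x z Sz t tk].
- by rewrite wact0.
- by rewrite wactD Sz // Sw // addr0.
- by rewrite (wactZ qg) Sz // scaler0.
- case: t tk => [|x t] tk /=; first by have /= -> := Sz [::] tk; rewrite scaler0.
  rewrite scalerA (arr_idem qg); case: eqP => _; last by rewrite scale0r wact0.
  exact: (Sz (x :: t)).
rewrite -[wact t _]/(wact (x :: t) z) lastI wact_rcons Sz ?scaler0 //.
by rewrite size_belast.
Qed.

Hypothesis m_span : forall z, exists c : nat -> K, z = \sum_(j < n.+1) io (c j) *: xx j.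

Lemma killed_by_lengthT : S n.+1 = setT.
Proof. by apply/seteqP; split=> // z _ t tn; apply: long0; rewrite tn. Qed.

Lemma killed_by_length0 : S 0 = [set 0].
Proof.
apply/seteqP; split=> [z /(_ [::] erefl) //|_ -> /= t _]; exact: wact0.
Qed.

Lemma killed_by_length_xx k i : (n < i + k)%N -> (i <= n)%N -> S k (xx i).
Proof.
move=> nik lin t tk; apply: contrapT => /(wact_xx lin)[].
by rewrite tk leqNgt nik.
Qed.

(** The word [drop i s] has at least [k] arrows and so kills the combination, but it also sends it
    to [c i] times the top. *)
Lemma killed_by_length_coef k (c : nat -> K) i : (i + k <= n)%N ->
  S k (\sum_(j < n.+1) io (c j) *: xx j) -> c i = 0.
Proof.
move=> ikn Sz; elim/ltn_ind: i ikn => i IH ikn.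
have lin : (i <= n)%N by apply: leq_trans ikn; apply: leq_addr.
apply: (scalar_eq0 (io := io) _ m_top).
rewrite -wact_drop_comb // => [|j ji]; last first.
  by apply: IH => //; apply: leq_trans ikn; rewrite leq_add2r ltnW.
by apply: killed_by_length_le Sz _ (erefl); rewrite size_drop leq_subRL.
Qed.

(** An element of [S k.+1] outside [S k] has its leading term exactly at [i0 = n - k]. Moving it
    along [s] gives elements of [L] with leading term at each later index. *)
Lemma killed_by_length_max k L : (k <= n)%N -> is_submodule L ->
  L `<=` S k.+1 -> ~ L `<=` S k -> L = S k.+1.
Proof.
move=> kn Ls LS /not_subset[z Lz Sz].
have [c zE] := m_span z; set i0 := (n - k)%N.
have c0 i : (i < i0)%N -> c i = 0.
  move=> lt; apply: (@killed_by_length_coef k.+1); last by rewrite -zE; apply: LS.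
  by rewrite addnS addnC -ltn_subRL.
have i0n : (i0 <= n)%N by apply: leq_subr.
have ci0 : c i0 != 0.
  apply: contra_notN Sz => /eqP c00; rewrite zE.
  apply: (@submod_sum _ _ _ _ _ _ (S k)) => [|j _]; first exact: killed_by_length_submodule.
  have [lt|gt|eq] := ltngtP j i0; last by rewrite eq c00 rmorph0 scale0r; case: (killed_by_length_submodule k).
    by rewrite c0 // rmorph0 scale0r; case: (killed_by_length_submodule k).
  apply: (@submodZ _ _ (S k)); first exact: killed_by_length_submodule.
  have jn : (j <= n)%N by rewrite -ltnS.
  by apply: killed_by_length_xx => //; rewrite addnC -ltn_subLR.
(* Induction on [n - i]: the vectors beyond [xx i] are already in [L], so the tail of the moved
   element can be subtracted. *)
have Lxx i : (i0 <= i)%N -> (i <= n)%N -> L (xx i).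
  move=> i0i lin; have [l le] := ubnP (n - i); elim: l i le i0i lin => // l IH i le i0i lin.
  set u := drop i0 (take i s).
  have su : size u = (i - i0)%N by rewrite size_drop size_takel.
  have : L (wact u z).
    rewrite /u; elim/last_ind: (drop _ _) => //= t x IHt.
    by rewrite wact_rcons; apply: submodZ.
  rewrite {1}zE wact_sum (bigD1 (Ordinal (i0n : (i0 < n.+1)%N))) //= (wactZ qg).
  have -> : wact u (xx i0) = xx i.
    by rewrite -wact_cat -{1}(take_takel s i0i) cat_take_drop.
  set rest := (\sum_(_ < _ | _) _).
  suff Lr : L rest.
    move=> Lsum; apply: (scalar_closed_cancel (scalar_closedP io Ls) ci0).
    by rewrite -[_ *: _](addrK rest); apply: submodB.
  apply: submod_sum => // j ji0; rewrite (wactZ qg).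
  have jn : (j <= n)%N by rewrite -ltnS.
  have [lt|gt|eq] := ltngtP j i0.
  - by rewrite c0 // rmorph0 scale0r; case: Ls.
  - apply: submodZ => //.
    have [->|/(wact_xx jn)[le' ->]] := pselect (wact u (xx j) = 0); first by case: Ls.
    rewrite su in le' *.
    have ij : (i < j + (i - i0))%N by rewrite addnBA // ltn_subRL ltn_add2r.
    apply: IH => //; last exact: leq_trans i0i (ltnW ij).
    by apply: leq_trans (ltn_sub2l (leq_trans ij le') ij) _; rewrite -ltnS.
  - by case/eqP: ji0; apply: val_inj.
apply/seteqP; split=> // y Sy; have [d yE] := m_span y.
rewrite yE; apply: submod_sum => // j _; have [lt|ge] := ltnP j i0.
  rewrite (_ : d j = 0) ?rmorph0 ?scale0r; first by case: Ls.
  apply: (@killed_by_length_coef k.+1 d); last by rewrite -yE.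
  by rewrite addnS addnC -ltn_subRL.
by apply: submodZ => //; apply: Lxx => //; rewrite -ltnS.
Qed.

Lemma killed_by_length_cases L : is_submodule L -> exists2 k, (k <= n.+1)%N & L = S k.
Proof.
move=> Ls; suff H l : L `<=` S l -> (l <= n.+1)%N -> exists2 k, (k <= n.+1)%N & L = S k.
  by apply: (H n.+1) => //; rewrite killed_by_lengthT.
elim: l => [|k IH] LS kn.
  exists 0%N => //; apply/seteqP; split=> //; rewrite killed_by_length0.
  exact: (submod_ge0 Ls).
have [LSk|nLS] := pselect (L `<=` S k); first by apply: IH => //; apply: ltnW.
by exists k.+1 => //; apply: killed_by_length_max.
Qed.

Lemma cover_killed_by_length k : (k <= n)%N -> is_maximal_submodule (S k) (S k.+1).
Proof.
move=> kn; apply: coverI.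
- exact: killed_by_length_submodule.
- exact: killed_by_length_le.
- exists (xx (n - k)).
    by apply: killed_by_length_xx; rewrite ?leq_subr // addnS subnK.
  move/(_ (drop (n - k) s)); rewrite size_drop subKn // => /(_ erefl).
  by rewrite xx_drop ?leq_subr // => /m_top.
move=> L Ls SL LS; have [LSk|nLS] := pselect (L `<=` S k); first by left; apply/seteqP.
by right; apply: killed_by_length_max.
Qed.

Lemma series_killed_by_length k l : (k + l <= n.+1)%N ->
  series (S k) [seq S j | j <- iota k.+1 l] (S (k + l)).
Proof.
elim: l k => [|l IH] k kl /=; first by rewrite addn0.
rewrite addnS -addSn in kl *; split; last exact: IH.
by apply: cover_killed_by_length; rewrite -ltnS; apply: leq_trans kl; apply: leq_addr.
Qed.

Lemma chain_uniserial : uniserial M.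
Proof.
apply/uniserialP; split.
  exists [seq S k | k <- iota 1 n.+1]; apply/composition_seriesP.
  by rewrite -killed_by_length0 -killed_by_lengthT; apply: (series_killed_by_length (k := 0)).
move=> U V /killed_by_length_cases[k _ ->] /killed_by_length_cases[l _ ->].
by have [kl|/ltnW lk] := leqP k l; [left|right]; apply: killed_by_length_le.
Qed.

End ChainModules.

(** * Forks: a top vector and its images under two arrows *)

Section ForkModules.
Local Open Scope classical_set_scope.
Variables (K : fieldType) (Q : quiver) (A : pzRingType).
Variables (io : {rmorphism K -> A}) (E : vertex Q -> A) (X : arrow Q -> A).
Hypothesis qg : quiver_generated io E X.
Variables (M : lmodType A) (m : M) (x y : arrow Q).
Implicit Types z : M.
Hypotheses (xm : X x *: m <> 0) (ym : X y *: m <> 0).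
Hypothesis XXm : forall u v, X u *: (X v *: m) = 0.
Hypothesis xy_tgt : tgt x <> tgt y.
Hypothesis m_span : forall z, exists c0 c1 c2,
  z = io c0 *: m + (io c1 *: (X x *: m) + io c2 *: (X y *: m)).

Let idemX u c : E c *: (X u *: m) = if tgt u == c then X u *: m else 0.
Proof. by rewrite scalerA (idem_arr qg); case: eqP; rewrite ?scale0r. Qed.

Definition arrow_line u : set M := [set z | exists c, z = io c *: (X u *: m)].
Definition arrow_plane : set M :=
  [set z | exists c1 c2, z = io c1 *: (X x *: m) + io c2 *: (X y *: m)].

Lemma arrow_line_submodule u : is_submodule (arrow_line u).
Proof.
have L0 : arrow_line u 0 by exists 0; rewrite rmorph0 scale0r.
apply: (submodule_gen qg) => // [_ _ [c1 ->] [c2 ->]|d _ [c ->]|c _ [d ->]|v _ [d ->]].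
- by exists (c1 + c2); rewrite rmorphD scalerDl.
- by exists (d * c); rewrite rmorphM scalerA.
- by rewrite (scalar_swap qg) idemX; case: eqP => _; [exists d | rewrite scaler0].
- by rewrite (scalar_swap qg) XXm scaler0.
Qed.

Lemma arrow_planeE : arrow_plane = submod_add (arrow_line x) (arrow_line y).
Proof.
apply/seteqP; split=> [_ [c1 [c2 ->]]|_ [_ [_ [[c1 ->] [c2 ->] ->]]]].
  by exists (io c1 *: (X x *: m)), (io c2 *: (X y *: m)); split=> //; [exists c1|exists c2].
by exists c1, c2.
Qed.

Lemma arrow_plane_submodule : is_submodule arrow_plane.
Proof. by rewrite arrow_planeE; apply: submod_addP; apply: arrow_line_submodule. Qed.

Lemma arrow_line_cover u : X u *: m <> 0 -> is_maximal_submodule [set 0] (arrow_line u).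
Proof.
move=> um; apply: (cover_codim1 (io := io) (v := X u *: m)) => //.
- exact: submod0.
- exact: submod_ge0 (arrow_line_submodule u).
- by exists 1; rewrite rmorph1 scale1r.
- by move=> _ [c ->]; exists c => /=; rewrite subrr.
Qed.

(** The idempotent at [tgt u] fixes one line and kills the other. *)
Lemma arrow_line_disjoint u v : tgt u <> tgt v -> X u *: m <> 0 -> ~ arrow_line v (X u *: m).
Proof.
move=> uv um [c uE]; apply: um; have := idemX u (tgt u); rewrite eqxx {1}uE.
by rewrite (scalar_swap qg) idemX; case: eqP => [/esym //|_]; rewrite scaler0.
Qed.

Lemma arrow_line_plane u v : arrow_plane = submod_add (arrow_line u) (arrow_line v) ->
  tgt u <> tgt v -> X v *: m <> 0 -> is_maximal_submodule (arrow_line u) arrow_plane.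
Proof.
move=> pE uv vm; apply: (cover_codim1 (io := io) (v := X v *: m)).
- exact: arrow_line_submodule.
- by rewrite pE; apply: submod_addl; apply: arrow_line_submodule.
- rewrite pE; apply: submod_addr; first by case: (arrow_line_submodule u).
  by exists 1; rewrite rmorph1 scale1r.
- by apply: arrow_line_disjoint => // /esym.
- rewrite pE => _ [z [_ [Uz [c ->] ->]]]; exists c.
  by rewrite addrK.
Qed.

Lemma arrow_plane_killed u z : arrow_plane z -> X u *: z = 0.
Proof.
move=> [c1 [c2 ->]].
by rewrite scalerDr !(scalar_swap qg) !XXm !scaler0 addr0.
Qed.

Lemma arrow_plane_coef c0 c1 c2 u :
  X u *: (io c0 *: m + (io c1 *: (X x *: m) + io c2 *: (X y *: m))) = io c0 *: (X u *: m).
Proof.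
rewrite scalerDr (scalar_swap qg) [X in _ + X](arrow_plane_killed u) ?addr0 //.
by exists c1, c2.
Qed.

Lemma arrow_plane_cover : is_maximal_submodule arrow_plane setT.
Proof.
apply: (cover_codim1 (io := io) (v := m)) => //; first exact: arrow_plane_submodule.
  by move=> /(arrow_plane_killed x).
move=> t _; have [c0 [c1 [c2 ->]]] := m_span t; exists c0.
by rewrite addrAC subrr add0r; exists c1, c2.
Qed.

(** An element outside the plane has a nonzero coefficient at [m]. Arrows kill the plane, so they
    send this element to nonzero multiples of the two images of [m]; subtracting these leaves
    [m]. *)
Lemma arrow_plane_local L : is_submodule L -> L = setT \/ L `<=` arrow_plane.
Proof.
move=> Ls; have [|/not_subset[z Lz Nz]] := pselect (L `<=` arrow_plane); first by right.
left; apply/seteqP; split=> // t _.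
have [c0 [c1 [c2 zE]]] := m_span z.
have c00 : c0 != 0.
  apply: contra_notN Nz => /eqP c00; exists c1, c2.
  by rewrite zE c00 rmorph0 scale0r add0r.
have LX u : L (X u *: m).
  apply: (scalar_closed_cancel (scalar_closedP io Ls) c00).
  by rewrite -(arrow_plane_coef c0 c1 c2 u) -zE; apply: submodZ.
have Lp d1 d2 : L (io d1 *: (X x *: m) + io d2 *: (X y *: m)).
  by apply: submodD => //; apply: submodZ.
have Lm : L m.
  apply: (scalar_closed_cancel (scalar_closedP io Ls) c00).
  rewrite -[_ *: m](addrK (io c1 *: (X x *: m) + io c2 *: (X y *: m))) -zE.
  exact: submodB.
have [d0 [d1 [d2 ->]]] := m_span t.
by apply: submodD => //; apply: submodZ.
Qed.

Lemma fork_two_factor_serial : two_factor_serial M.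
Proof.
apply: (two_factor_serial_diamond (P := arrow_line x) (Q := arrow_line y) (N := arrow_plane)).
- exact: arrow_line_cover.
- exact: arrow_line_cover.
- by apply: arrow_line_plane ym => //; apply: arrow_planeE.
- apply: arrow_line_plane xm => [|/esym//]; rewrite arrow_planeE.
  by apply/seteqP; split=> _ [u [v [Uu Vv ->]]]; exists v, u; rewrite addrC.
- move=> xyE; apply: (arrow_line_disjoint xy_tgt xm); rewrite -xyE.
  by exists 1; rewrite rmorph1 scale1r.
- exact: arrow_plane_cover.
- exact: arrow_plane_local.
Qed.

Lemma fork_indecomposable : indecomposable M.
Proof.
apply: (indecomposable_local (N := arrow_plane)).
- by have [_ _ [z _ Nz] _] := coverP arrow_plane_cover; move=> NT; apply: Nz; rewrite NT.
- exact: arrow_plane_local.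
- exact: arrow_plane_submodule.
Qed.

End ForkModules.

(** * Classification of the indecomposable modules *)

Section Classification.
Local Open Scope classical_set_scope.
Variables (K : fieldType) (Q : quiver) (A : pzRingType).
Variables (io : {rmorphism K -> A}) (E : vertex Q -> A) (X : arrow Q -> A).
Hypothesis qg : quiver_generated io E X.
Hypothesis indeg : forall x y : arrow Q, tgt x = tgt y -> x = y.
Variable M : lmodType A.
Implicit Types (z w : M) (x y u v : arrow Q) (s t : seq (arrow Q)).
Local Notation wact := (wact X).
Hypotheses (indM : indecomposable M) (spM : scalar_spanned io M).

(** * Splitting off a fork when paths of length two act as zero *)

Section Fork.
Hypothesis XX0 : forall u v z, X u *: (X v *: z) = 0.
Variables (m : M) (x y : arrow Q).
Hypothesis m_idem : E (src x) *: m = m.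
Hypotheses (xm : X x *: m <> 0) (ym : X y *: m <> 0) (xy : x <> y).
Hypothesis ker_eq : forall z, X x *: z = 0 <-> X y *: z = 0.
Hypothesis m_arr : forall u, [\/ u = x, u = y | X u *: m = 0].

(** Vanishing on the kernel of [x] makes [f z] depend only on [X x *: z], which allows it to be
    transported to the image of [x]. *)
Lemma fork_top_functional : exists f : M -> K,
  [/\ forall z w, f (z + w) = f z + f w, forall c z, f (io c *: z) = c * f z,
      forall z, X x *: z = 0 -> f z = 0 & f m = 1].
Proof.
have Hs : scalar_closed io [set z : M | X x *: z = 0].
  split=> [|c z w /= z0 w0]; first exact: scaler0.
  by rewrite scalerDr (scalar_swap qg) z0 w0 scaler0 addr0.
have [f [fD fZ fH fm]] := separating_functional spM Hs xm.
by exists f.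
Qed.

(** The rule [g (X u *: z) = f z] is obtained by separating [X u *: m] from [m] and from the images
    under [u] of the kernel of [f]. Composition with the idempotent at [tgt u] then removes the
    images of all other arrows, as none of them ends there. *)
Lemma fork_socle_functional (f : M -> K) u : X u *: m <> 0 ->
    (forall z w, f (z + w) = f z + f w) -> (forall c z, f (io c *: z) = c * f z) ->
    (forall z, X u *: z = 0 -> f z = 0) -> f m = 1 ->
  exists g : M -> K,
    [/\ forall z w, g (z + w) = g z + g w, forall c z, g (io c *: z) = c * g z,
      forall v z, g (X v *: z) = if v == u then f z else 0,
      forall c z, g (E c *: z) = if c == tgt u then g z else 0 & g m = 0].
Proof.
move=> um fD fZ fker fm.
have f0 : f 0 = 0 by apply: fker; rewrite scaler0.
have fN z : f (- z) = - f z.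
  by apply/eqP; rewrite -addr_eq0 -fD addNr f0.
pose H : set M := [set w | exists z c, f z = 0 /\ w = X u *: z + io c *: m].
have Hs : scalar_closed io H.
  split=> [|c _ _ [z1 [c1 [z10 ->]]] [z2 [c2 [z20 ->]]]].
    by exists 0, 0; rewrite rmorph0 scale0r scaler0 addr0.
  exists (io c *: z1 + z2), (c * c1 + c2); split; first by rewrite fD fZ z10 z20 mulr0 addr0.
  rewrite scalerDr [X u *: (_ + _)]scalerDr [X u *: (io c *: _)](scalar_swap qg).
  by rewrite rmorphD rmorphM scalerDl -scalerA addrACA.
(* Applying [X u] once more kills every product of two arrows and leaves [c = 0]. Then [X u] kills
   [m - z], which would give [f m = f z = 0]. *)
have Hu : ~ H (X u *: m).
  move=> [z [c [fz uE]]].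
  have c0 : c = 0.
    apply: (scalar_eq0 (io := io) _ um); rewrite -(scalar_swap qg).
    have -> : io c *: m = X u *: m - X u *: z by rewrite uE addrC addKr.
    by rewrite scalerDr scalerN !XX0 subr0.
  have : f (m - z) = 0.
    apply: fker; rewrite scalerDr scalerN uE c0 rmorph0 scale0r addr0.
    by rewrite subrr.
  by rewrite fD fN fz subr0 fm => /eqP; rewrite oner_eq0.
have [g [gD gZ gH gu]] := separating_functional spM Hs Hu.
have g0 : g 0 = 0 by apply: gH; case: Hs.
have gm : g m = 0.
  by apply: gH; exists 0, 1; rewrite f0 scaler0 add0r rmorph1 scale1r.
exists (fun z => g (E (tgt u) *: z)); split=> [z w|c z|v z|c z|].
- by rewrite scalerDr gD.
- by rewrite (scalar_swap qg) gZ.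
- rewrite scalerA (idem_arr qg); case: (v =P u) => [->|vu]; last first.
    by case: eqP => [/indeg//|_]; rewrite scale0r.
  rewrite eqxx -[z](subrK (io (f z) *: m)) scalerDr gD (scalar_swap qg) gZ gu mulr1.
  rewrite fD fZ fm mulr1; congr (_ + _).
  have -> : f (z - io (f z) *: m) = 0 by rewrite fD fN fZ fm mulr1 subrr.
  apply: gH; exists (z - io (f z) *: m), 0; rewrite fD fN fZ fm mulr1 subrr.
  by rewrite rmorph0 scale0r addr0.
- rewrite scalerA (qg_idemM qg) eq_sym; case: eqP => [->//|_].
  by rewrite scale0r.
rewrite -m_idem scalerA (qg_idemM qg); case: eqP => _; last by rewrite scale0r.
by rewrite m_idem.
Qed.

(** The coordinates of the retraction are [f], [g] and [h]. Equality of the two kernels lets one [f]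
    serve both arrows, which is needed for [r] to commute with each of them. *)
Lemma fork_span z : exists c0 c1 c2,
  z = io c0 *: m + (io c1 *: (X x *: m) + io c2 *: (X y *: m)).
Proof.
have [f [fD fZ fker fm]] := fork_top_functional.
have [g [gD gZ gX gE gm]] := fork_socle_functional xm fD fZ fker fm.
have fker' w : X y *: w = 0 -> f w = 0 by move/ker_eq/fker.
have [h [hD hZ hX hE hm]] := fork_socle_functional ym fD fZ fker' fm.
have fX u w : f (X u *: w) = 0 by apply: fker; rewrite XX0.
have fE c w : f (E c *: w) = if c == src x then f w else 0.
  case: (c =P src x) => [->|cx]; last first.
    by apply: fker; rewrite scalerA (arr_idem qg); case: eqP => [/esym//|]; rewrite scale0r.
  have f0 : f (E (src x) *: w - w) = 0.
    by apply: fker; rewrite scalerDr scalerN scalerA (qg_arr_src qg) subrr.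
  by rewrite -[E _ *: w](subrK w) fD f0 add0r.
pose r w := io (f w) *: m + (io (g w) *: (X x *: m) + io (h w) *: (X y *: m)).
have rD w w' : r (w + w') = r w + r w'.
  by rewrite /r fD gD hD !rmorphD !scalerDl [RHS]addrACA; congr (_ + _); rewrite addrACA.
have rZ c w : r (io c *: w) = io c *: r w.
  by rewrite /r fZ gZ hZ !rmorphM !scalerDr !scalerA.
have Em c : E c *: m = if c == src x then m else 0.
  rewrite -m_idem scalerA (qg_idemM qg) eq_sym.
  by case: eqP => _; rewrite ?scale0r.
have EX c u : E c *: (X u *: m) = if c == tgt u then X u *: m else 0.
  by rewrite scalerA (idem_arr qg) eq_sym; case: eqP => _; rewrite ?scale0r.
have rE c w : r (E c *: w) = E c *: r w.
  rewrite /r fE gE hE !scalerDr !(scalar_swap qg (E c)) Em !EX.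
  by do 3!case: eqP => _; rewrite ?rmorph0 ?scale0r ?scaler0.
have rX u w : r (X u *: w) = X u *: r w.
  rewrite /r fX gX hX !scalerDr !(scalar_swap qg (X u)) !XX0 !scaler0 rmorph0 scale0r add0r !addr0.
  have [->|->|um] := m_arr u; rewrite ?eqxx.
  - by case: eqP => // _; rewrite rmorph0 scale0r addr0.
  - by case: eqP => [/esym//|_]; rewrite rmorph0 scale0r add0r.
  - rewrite um scaler0; case: eqP => [e|_]; first by case: xm; rewrite -e.
    case: eqP => [e|_]; first by case: ym; rewrite -e.
    by rewrite rmorph0 !scale0r addr0.
have rlin := linear_gen qg rD rZ rE rX.
have rm : r m = m by rewrite /r fm gm hm rmorph1 rmorph0 !scale0r !addr0 scale1r.
have rr w : r (r w) = r w.
  by rewrite {2}/r !rD !rZ !rlin rm.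
have m0 : m <> 0 by move=> m0; apply: xm; rewrite m0 scaler0.
exists (f z), (g z), (h z).
by rewrite -[LHS](retraction_id indM rD rlin rr m0 rm).
Qed.

Lemma fork_classification : two_factor_serial M.
Proof.
apply: (fork_two_factor_serial qg xm ym) => [u v|e|].
- exact: XX0.
- by apply: xy; apply: indeg.
- exact: fork_span.
Qed.
End Fork.

Hypothesis outdeg : forall x y z : arrow Q,
  src x = src y -> src x = src z -> x <> y -> z = x \/ z = y.
(** Condition (iv) for words: the lengths are [size s + 1] and [size t + 1], so a total of 2 reads
    as 0. *)
Hypothesis branching : forall x s y t, src x = src y ->
  (exists z, wact (x :: s) z <> 0) -> (exists z, wact (y :: t) z <> 0) ->
  ~~ prefix (x :: s) (y :: t) -> ~~ prefix (y :: t) (x :: s) -> (size s + size t = 0)%N.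
Hypothesis nilpotent : exists k, forall t z, (k <= size t)%N -> wact t z = 0.

Lemma longest_word : exists t z a, [/\ E a *: z = z, wact t z <> 0 &
  forall s w, (size t < size s)%N -> wact s w = 0].
Proof.
pose P n := `[< exists t z, size t = n /\ wact t z <> 0 >].
have P0 : exists n, P n.
  by have [[z z0] _] := indM; exists 0%N; apply/asboolP; exists [::], z.
have [k nil] := nilpotent.
have Pk n : P n -> (n <= k)%N.
  move=> /asboolP[t [z [<- nz]]]; rewrite leqNgt; apply/negP => /ltnW/nil.
  by move/(_ z)/nz.
case: (ex_maxnP P0 Pk) => n /asboolP[t [z [tn nz]]] max.
have [a az] : exists a, wact t (E a *: z) <> 0.
  apply: contrapT => no; apply: nz; rewrite (idem_decomp qg z) wact_sum big1 // => a _.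
  by apply: contrapT => ?; apply: no; exists a.
exists t, (E a *: z), a; split=> //; first by rewrite scalerA (qg_idemM qg) eqxx.
move=> s w ts; apply: contrapT => sw; have /max : P (size s) by apply/asboolP; exists s, w.
by rewrite leqNgt -tn ts.
Qed.

(** The second alternative records the two arrows because they later witness condition (iii). *)
Lemma classification : uniserial M \/
  (exists x y, [/\ x <> y, src x = src y & two_factor_serial M]).
Proof.
have [t [m [a [am tm long]]]] := longest_word.
have chain n' (m' : M) a' t' : E a' *: m' = m' -> size t' = n' -> size t = n' -> wact t' m' <> 0 ->
    (forall s, (size s <= n')%N -> wact s m' <> 0 -> s = take (size s) t') -> uniserial M.
  move=> am' <- tt' tm' ch; rewrite tt' in long.
  apply: (chain_uniserial qg tm' long ch).
  exact: (chain_span qg am' tm' long ch indM spM indeg).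
(* Incomparable words acting nontrivially on [m] both have length 1 by [branching]; hence unless [t]
   has length 1, all of them are prefixes of [t]. *)
have [t1|nt1] := eqVneq (size t) 1%N; last first.
  left; apply: (chain (size t) m a t) => // -[|x s] ut xum; first by rewrite take0.
  case: t tm ut nt1 {long chain} => [|y t] // ytm ut nt1.
  have [p|np] := boolP (prefix (x :: s) (y :: t)).
    by apply/esym/eqP; rewrite -prefixE.
  have [p|np'] := boolP (prefix (y :: t) (x :: s)).
    have := p; rewrite prefixE take_oversize // => /eqP <-.
    by rewrite take_size.
  have src_xy : src x = src y.
    by rewrite (wact_cons_src qg am xum) (wact_cons_src qg am ytm).
  have := branching src_xy (ex_intro _ m xum) (ex_intro _ m ytm) np np'.
  by move/eqP; rewrite addn_eq0 => /andP[_ /eqP t0]; rewrite /= t0 in nt1.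
have XX0 u v z : X u *: (X v *: z) = 0 by apply: (long [:: v; u]); rewrite t1.
(* If some vector at [src x] survives [x] but no other arrow, it spans a chain of length 1.
   Otherwise every arrow that acts nontrivially on a vector has a companion with the same source, so
   the two arrows at a vertex have equal kernels. *)
have [[m' [x [xm' only]]]|no] :=
  pselect (exists (m' : M) x, X x *: m' <> 0 /\ forall u, u <> x -> X u *: (E (src x) *: m') = 0).
  left; apply: (chain 1%N (E (src x) *: m') (src x) [:: x]) => //=.
  - by rewrite scalerA (qg_idemM qg) eqxx.
  - by rewrite scalerA (qg_arr_src qg).
  - move=> [|u [|v w]] //= _ um; congr cons.
    by apply: contrapT => /only.
right; case: t tm t1 {long chain} => [|x [|]] //= xm _.
have no' z u : X u *: z <> 0 -> exists v, [/\ v <> u, src v = src u & X v *: z <> 0].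
  move=> uz; apply: contrapT => h; apply: no; exists z, u; split=> // v vu.
  apply: contrapT => vz; apply: h.
  have e : src v = src u.
    by move: vz; rewrite scalerA (arr_idem qg); case: eqP; rewrite ?scale0r.
  by exists v; split=> //; move: vz; rewrite scalerA -e (qg_arr_src qg).
have [y [yx src_yx ym]] := no' m x xm.
exists x, y; split=> //; first by move/esym.
have only_xy u : src u = src x -> u = x \/ u = y.
  by move=> e; apply: outdeg => // /esym.
have ax : src x = a := wact_cons_src (s := [::]) qg am xm.
apply: (fork_classification XX0 (m := m) (x := x) (y := y)) => //.
- by rewrite ax.
- by move/esym.
- move=> z; split=> [xz|yz]; apply: contrapT => /no'[v [vu e vz]].
    by case: (only_xy v) => [|ev|ev]; [rewrite e | rewrite ev in vz | ].
  by case: (only_xy v) => [|ev|ev]; [rewrite e | | rewrite ev in vz].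
- move=> u; have [um|um] := pselect (X u *: m = 0); first by constructor 3.
  have /only_xy[->|->] : src u = src x; [|by constructor 1|by constructor 2].
  by rewrite ax; apply: (wact_cons_src (s := [::]) qg am um).
Qed.
End Classification.

(** * Path algebras and bound quiver algebras *)

Section PathAlgebraTheory.
Local Open Scope classical_set_scope.
Variables (K : fieldType) (Q : quiver).
Local Notation KQ := (path_algebra K Q).
Implicit Types (f g : KQ) (p q r : qpath Q) (c d : K) (a b : vertex Q).
Implicit Types (x y : arrow Q) (s t : seq (arrow Q)).
Local Notation path_elt := (path_elt K).
Local Notation arrow_elt := (arrow_elt K).
Local Notation idem a := (path_elt (lazy_path a)).

Lemma malgUZ c d p : c *: (<< d *g p >> : KQ) = << (c * d) *g p >>.
Proof. exact: (opathZ c d (Some p)). Qed.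

Lemma pa_scaleAr c f g : c *: (f * g) = f * (c *: g).
Proof.
elim/malgU_ind: f => [|f1 f2 IH1 IH2|d p]; first by rewrite !mul0r scaler0.
  by rewrite !mulrDl scalerDr IH1 IH2.
elim/malgU_ind: g => [|g1 g2 IH1 IH2|e q]; first by rewrite scaler0 !mulr0 scaler0.
  by rewrite mulrDr !scalerDr mulrDr IH1 IH2.
rewrite malgUZ -[X in c *: X]/(pa_mul _ _) -[RHS]/(pa_mul _ _) !pa_mulUU opathZ.
by rewrite mulrCA.
Qed.

(** Unlike a path, a word needs no proof of composability, so induction on the list is direct; it is
    0 when consecutive arrows do not compose. *)
Definition word s : KQ := \prod_(x <- s) arrow_elt x.

Lemma word_cat s t : word (s ++ t) = word s * word t.
Proof. exact: big_cat. Qed.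

Lemma word_cons x s : word (x :: s) = arrow_elt x * word s.
Proof. exact: big_cons. Qed.

Lemma word_rcons s x : word (rcons s x) = word s * arrow_elt x.
Proof. by rewrite -cats1 word_cat /word big_seq1. Qed.

Lemma idem_word a s : idem a * word s = 0 \/
  exists p, [/\ psource p = a, parrows p = s & idem a * word s = path_elt p].
Proof.
elim/last_ind: s => [|s x [E|[p [pa ps E]]]].
- by right; exists (lazy_path a); rewrite /word big_nil mulr1.
- by left; rewrite word_rcons mulrA E mul0r.
rewrite word_rcons mulrA E /arrow_elt path_eltM; case: path_compP => [r _ rE|_]; last by left.
by right; exists r; rewrite /psource /parrows rE ps cats1 /= pa.
Qed.

Lemma qpath_eq p q : psource p = psource q -> parrows p = parrows q -> p = q.
Proof.
move=> e1 e2; apply/val_inj => /=; rewrite [LHS]surjective_pairing [RHS]surjective_pairing.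
by congr pair.
Qed.

Lemma path_elt_word p : path_elt p = idem (psource p) * word (parrows p).
Proof.
case: p => [[a s] H]; rewrite /psource /parrows /=.
elim/last_ind: s H => [|s x IH] H.
  by rewrite /word big_nil mulr1; congr path_elt; apply: qpath_eq.
have H' : is_qpath (a, s).
  by move: H; rewrite /is_qpath /=; case: s {IH} => //= y s; rewrite rcons_path => /and3P[-> ->].
rewrite word_rcons mulrA -(IH H') /arrow_elt path_eltM.
case: path_compP => [r _ rE|[]] /=.
  by congr path_elt; apply: qpath_eq; rewrite /psource /parrows rE //= cats1.
rewrite /ptarget /psource /parrows /=.
move: H; rewrite /is_qpath /=; case: s {IH H'} => [/andP[/eqP ->]|y s] //=.
by rewrite rcons_path last_map => /and3P[_ _ /eqP].
Qed.

Lemma path_elt_word_cons p x s : parrows p = x :: s -> path_elt p = word (x :: s).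
Proof.
move=> pxs; rewrite path_elt_word pxs word_cons mulrA.
have := qpathP p; rewrite /is_qpath -/(parrows p) pxs /= => /andP[/eqP sx _].
by rewrite /arrow_elt path_eltM path_comp_lazyl /psource -sx eqxx.
Qed.

Lemma arrow_elt_idem x : arrow_elt x = idem (src x) * arrow_elt x.
Proof. by rewrite {1}/arrow_elt path_elt_word /word big_seq1. Qed.

Lemma idem_arrow a x : idem a * arrow_elt x = if a == src x then arrow_elt x else 0.
Proof.
by rewrite /arrow_elt path_eltM path_comp_lazyl; case: ifP.
Qed.

Lemma arrow_idem a x : arrow_elt x * idem a = if tgt x == a then arrow_elt x else 0.
Proof. by rewrite /arrow_elt path_eltM path_comp_lazyr; case: ifP. Qed.

Lemma idem_idem a b : idem a * idem b = if a == b then idem b else 0.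
Proof. by rewrite path_eltM path_comp_lazyl; case: ifP. Qed.

Lemma path_elt_idem p a : path_elt p * idem a = if ptarget p == a then path_elt p else 0.
Proof. by rewrite path_eltM path_comp_lazyr; case: ifP. Qed.

Lemma idem_path_elt p a : idem a * path_elt p = if a == psource p then path_elt p else 0.
Proof. by rewrite path_eltM path_comp_lazyl; case: ifP. Qed.

Lemma arrow_mul_composable x y : arrow_elt x * arrow_elt y <> 0 -> tgt x = src y.
Proof.
rewrite (arrow_elt_idem y) mulrA arrow_idem; case: eqP => //.
by rewrite mul0r.
Qed.

(** The filtration by path length, stated by coefficients: it bounds the powers of the arrow ideal,
    which are given only by generators. *)
Definition deg_ge n f := forall p, (plength p < n)%N -> f@_p = 0.

Lemma deg_ge_opath n c (o : option (qpath Q)) :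
  (forall p, o = Some p -> (n <= plength p)%N) -> deg_ge n (opath c o).
Proof.
case: o => [q|] on p pn /=; last by rewrite mcoeff0.
rewrite mcoeffU; case: eqP => // qp; have := on q erefl.
by rewrite qp leqNgt pn.
Qed.

Lemma deg_geD n f g : deg_ge n f -> deg_ge n g -> deg_ge n (f + g).
Proof. by move=> df dg p pn; rewrite mcoeffD df // dg // addr0. Qed.

Lemma deg_ge0 n : deg_ge n 0.
Proof. by move=> p _; rewrite mcoeff0. Qed.

Lemma plength_comp p q r : path_comp p q = Some r -> plength r = (plength p + plength q)%N.
Proof.
case: path_compP => // r' _ rE [<-].
by rewrite /plength /parrows rE /= size_cat.
Qed.

Lemma deg_geM m n f g : deg_ge m f -> deg_ge n g -> deg_ge (m + n) (f * g).
Proof.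
move=> df dg; rewrite -[f * g]/(pa_mul f g) pa_mulE.
rewrite big_seq; apply: big_ind => [||p pf]; [exact: deg_ge0|exact: deg_geD|].
rewrite big_seq; apply: big_ind => [||q qg]; [exact: deg_ge0|exact: deg_geD|].
apply: deg_ge_opath => r /plength_comp ->; apply: leq_add.
  by rewrite leqNgt; apply/negP => /df; move: pf; rewrite -mcoeff_neq0 => /eqP.
by rewrite leqNgt; apply/negP => /dg; move: qg; rewrite -mcoeff_neq0 => /eqP.
Qed.

Lemma deg_ge_ideal n : is_ideal (deg_ge n).
Proof.
split=> [|f g|f g dg|f g df]; [exact: deg_ge0|exact: deg_geD| |].
  by rewrite -[n]add0n; apply: deg_geM.
by rewrite -[n]addn0; apply: deg_geM.
Qed.

Lemma ideal_pow_deg_ge n : ideal_pow (@arrow_ideal K Q) n `<=` deg_ge n.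
Proof.
have J1 : @arrow_ideal K Q `<=` deg_ge 1.
  move=> f /(_ _ (deg_ge_ideal 1)); apply=> _ [x _ <-] p p0.
  rewrite /Defs.arrow_elt /Defs.path_elt mcoeffU; case: eqP => // xp.
  by move: p0; rewrite -xp.
elim: n => [|n IH] f //= /(_ _ (deg_ge_ideal n.+1)); apply.
move=> _ [g /J1 g1 [h /IH hn <-]].
by rewrite -add1n; apply: deg_geM.
Qed.

Lemma word_ideal_pow n s : (n <= size s)%N -> ideal_pow (@arrow_ideal K Q) n (word s).
Proof.
elim: n s => [|n IH] [|x s] //= ns; rewrite word_cons => J Ji; apply.
exists (arrow_elt x); first by move=> J' J'i; apply; exists x.
by exists (word s) => //; apply: IH.
Qed.

(** * Relations in an admissible ideal *)

Section Admissible.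
Variable I : ideal KQ.
Hypothesis admI : admissible I.

Lemma admissible_deg f : I f -> deg_ge 2 f.
Proof. by have [_ I2] := admI => /I2 /ideal_pow_deg_ge. Qed.

Lemma admissible_long : exists k, forall s, (k <= size s)%N -> I (word s).
Proof.
have [[k _ kI] _] := admI; exists k => s ks.
by apply/kI/word_ideal_pow.
Qed.

Lemma ideal_sum (J : Type) (u : seq J) (P : pred J) (F : J -> KQ) :
  (forall i, P i -> I (F i)) -> I (\sum_(i <- u | P i) F i).
Proof.
by have [I0 ID _ _] := idealP I; move=> IF; apply: big_ind.
Qed.

Hypothesis indeg : forall x y : arrow Q, tgt x = tgt y -> x = y.

Lemma ptarget_rcons p s x : parrows p = rcons s x -> ptarget p = tgt x.
Proof. by rewrite /ptarget => ->; rewrite map_rcons last_rcons. Qed.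

Lemma qpath_rcons2 p s x y : parrows p = rcons (rcons s x) y -> tgt x = src y.
Proof.
have := qpathP p; rewrite /parrows /is_qpath; case: (qpath_val p) => a t /= + tE.
rewrite tE; case: s {tE} => [|z s] /=; first by case/and3P=> _ /eqP.
by rewrite rcons_path last_rcons => /and3P[_ _ /eqP].
Qed.

(** Read backwards from the common target, the arrows are forced because at most one ends at each
    vertex. *)
Lemma suffix2 p q x y : parrows p = [:: x; y] -> ptarget q = ptarget p ->
  (2 <= plength q)%N -> exists u, parrows q = u ++ [:: x; y].
Proof.
move=> pxy qp q2.
have [u [x' [y' qE]]] : exists u x' y', parrows q = rcons (rcons u x') y'.
  move: q2; rewrite /plength; case/lastP: (parrows q) => // s y'.
  by case/lastP: s => // u x' _; exists u, x', y'.
exists u.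
have yE : y' = y.
  by apply: indeg; rewrite -(ptarget_rcons qE) qp (ptarget_rcons (s := [:: x]) pxy).
have xE : x' = x.
  apply: indeg; rewrite (qpath_rcons2 qE) (qpath_rcons2 (s := [::]) (p := p) pxy).
  by rewrite yE.
by rewrite qE -!cats1 -catA xE yE.
Qed.

(* Every other path with the same ends as [p] is [r p] for a nontrivial cycle
   [r]; all long enough [r p] are in [I], and descending induction on the
   length of [r] brings this down to [p]. *)
Lemma monomial2 p f : plength p = 2 -> I f -> f@_p != 0 -> I (path_elt p).
Proof.
move=> p2 If fp; have [I0 ID IMl IMr] := idealP I.
have [x [y pxy]] : exists x y, parrows p = [:: x; y].
  by move: p2; rewrite /plength; case: (parrows p) => [|x [|y []]] // _; exists x, y.
set a := psource p; set b := ptarget p.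
have pE := path_elt_word_cons pxy.
have [k long] := admissible_long.
suff H l s : (k <= size s + l)%N -> I (word s * path_elt p).
  by have := H k [::]; rewrite /word big_nil mul1r; apply.
elim: l s => [|l IH] s; first by rewrite addn0 => /long/IMr.
move=> ksl; have : I (word s * (idem a * f * idem b)) by apply/IMl/IMr/IMl.
have -> : idem a * f * idem b = \sum_(q <- msupp f) f@_q *: (idem a * path_elt q * idem b).
  rewrite {1}[f]monalgE mulr_sumr mulr_suml; apply: eq_bigr => q _.
  have -> : << f@_q *g q >> = f@_q *: path_elt q by rewrite malgUZ mulr1.
  by rewrite -pa_scaleAr -pa_scaleAl.
have pf : p \in msupp f by rewrite -mcoeff_neq0.
rewrite (big_fsetD1 p) //= mulrDr; set rest := \sum_(_ <- _) _.
have Irest : I (word s * rest).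
  rewrite /rest mulr_sumr big_seq; apply: ideal_sum => q; rewrite !inE => /andP[qp qf].
  rewrite -pa_scaleAr -[X in _ *: X]mul1r pa_scaleAl; apply: IMl.
  rewrite idem_path_elt; case: eqP => [aq|_]; last by rewrite mul0r mulr0.
  rewrite path_elt_idem; case: eqP => [bq|_]; last by rewrite mulr0.
  have q2 : (2 <= plength q)%N.
    by rewrite leqNgt; apply/negP => /(admissible_deg If); move: qf; rewrite -mcoeff_neq0 => /eqP.
  have [u qE] := suffix2 pxy bq q2.
  case: u qE => [|z u] qE.
    by case/eqP: qp; apply: qpath_eq; rewrite ?pxy.
  rewrite path_elt_word -aq qE word_cat -pE word_cons !mulrA -[word s * _ * _]mulrA idem_arrow.
  case: ifP => _; last by rewrite mulr0 !mul0r.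
  rewrite -[_ * word u]mulrA -word_cons -word_cat; apply: IH.
  by apply: leq_trans ksl _; rewrite size_cat /= -addnA leq_add2l addSn ltnS leq_addl.
have Z c g : I g -> I (c *: g).
  by move=> Ig; rewrite -[g]mul1r pa_scaleAl; apply: IMl.
rewrite idem_path_elt eqxx path_elt_idem eqxx -pa_scaleAr => Isum.
have : I (f@_p *: (word s * path_elt p)).
  rewrite -[_ *: _](addrK (word s * rest)); apply: ID => //.
  by rewrite -mulN1r; apply: IMl.
by move/(Z (f@_p)^-1); rewrite scalerA mulVf // scale1r.
Qed.

End Admissible.

(** * Generators of the bound quiver algebra *)

Section BoundQuiverRing.
Variable I : ideal KQ.
Local Notation cl := (quot_class I).
Local Notation R := (bound_quiver_algebra I).

Lemma cl0 : cl 0 = 0.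
Proof. by apply: (addrI (cl 0)); rewrite -quot_classD !addr0. Qed.

Lemma clM f g : cl (f * g) = cl f * cl g.
Proof. exact/esym/quot_mul_class. Qed.

Lemma cl_sum (J : Type) (u : seq J) (P : pred J) (F : J -> KQ) :
  cl (\sum_(i <- u | P i) F i) = \sum_(i <- u | P i) cl (F i).
Proof. exact: (big_morph cl (@quot_classD _ I) cl0). Qed.

Lemma cl_eq0 f : cl f = 0 <-> I f.
Proof. by rewrite -cl0; split=> [/quot_classP|If]; [|apply/quot_classP]; rewrite subr0. Qed.

Definition bqa_const c : R^c := cl (c *: (1 : KQ)).

Lemma bqa_const_zmod : zmod_morphism bqa_const.
Proof.
move=> c d; rewrite /bqa_const scalerBl quot_classD; congr (_ + _).
by apply: (addrI (cl (d *: (1 : KQ)))); rewrite -quot_classD !subrr cl0.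
Qed.

Lemma bqa_const_monoid : monoid_morphism bqa_const.
Proof.
split=> [|c d]; rewrite /bqa_const ?scale1r //.
rewrite -[RHS]/(cl (d *: (1 : KQ)) * cl (c *: (1 : KQ))) -clM; congr cl.
by rewrite -pa_scaleAl mul1r scalerA mulrC.
Qed.

HB.instance Definition _ := GRing.isZmodMorphism.Build K R^c bqa_const bqa_const_zmod.
HB.instance Definition _ := GRing.isMonoidMorphism.Build K R^c bqa_const bqa_const_monoid.

Definition bqa_idem a : R^c := cl (idem a).
Definition bqa_arrow x : R^c := cl (arrow_elt x).

Lemma bqa_generated : quiver_generated bqa_const bqa_idem bqa_arrow.
Proof.
have rM (u v : R) : (u : R^c) * (v : R^c) = v * u :> R by [].
split=> [c g||a b|x|x|P P0 PD Pc PE PX g].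
- elim/quot_ringW: g => g; rewrite !rM /bqa_const -!clM; congr cl.
  by rewrite -pa_scaleAl -pa_scaleAr mul1r mulr1.
- rewrite -[LHS]cl_sum; congr cl.
- by rewrite rM -clM idem_idem; case: eqP => [->|]; rewrite ?cl0.
- by rewrite rM -clM -arrow_elt_idem.
- by rewrite rM -clM arrow_idem eqxx.
elim/quot_ringW: g => g; elim/malgU_ind: g => [|f g|c p]; first by rewrite cl0.
  by rewrite quot_classD; apply: PD.
have -> : << c *g p >> = path_elt p * (c *: (1 : KQ)) :> KQ by rewrite -pa_scaleAr mulr1 malgUZ mulr1.
rewrite clM; apply: Pc; rewrite path_elt_word.
(* Appending an arrow to a path is left multiplication in the converse ring, which is the form of
   the induction principle. *)
elim/last_ind: (parrows p) => [|s x IH]; first by rewrite /word big_nil mulr1; apply: PE.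
by rewrite word_rcons mulrA clM; apply: PX.
Qed.

Lemma wprod_word s : wprod bqa_arrow s = cl (word s).
Proof.
elim/last_ind: s => [|s x IH]; first by rewrite /word big_nil.
by rewrite /wprod foldl_rcons -/(wprod _ _) IH word_rcons clM.
Qed.

Lemma wprod_path x s : wprod bqa_arrow (x :: s) <> 0 ->
  exists p, [/\ psource p = src x, parrows p = x :: s & is_bound_path I p].
Proof.
rewrite wprod_word => nz.
have E : word (x :: s) = idem (src x) * word (x :: s).
  by rewrite word_cons mulrA -arrow_elt_idem.
have [e0|[p [ps pa pE]]] := idem_word (src x) (x :: s).
  by case: nz; rewrite E e0 cl0.
by exists p; split=> //; rewrite /is_bound_path -pE -E => /cl_eq0.
Qed.

Lemma wprod_nilpotent : admissible I ->
  exists k, forall s, (k <= size s)%N -> wprod bqa_arrow s = 0.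
Proof.
move=> /admissible_long[k long]; exists k => s /long /cl_eq0 E.
by rewrite wprod_word.
Qed.

Lemma bqa_fg : finitely_generated (R : lmodType K) ->
  exists (n : nat) (g : 'I_n -> R^c), forall u, exists c : 'I_n -> K,
    u = \sum_i bqa_const (c i) * g i.
Proof.
move=> [n [g gen]]; exists n, g => u; have [c uE] := gen u; exists c; rewrite uE.
apply: eq_bigr => i _; elim/quot_ringW: (g i) => f.
rewrite -[RHS]/(cl f * cl (c i *: (1 : KQ))) -clM -pa_scaleAr mulr1.
exact: bqa_scale_class.
Qed.

End BoundQuiverRing.
End PathAlgebraTheory.

(** * Tree modules *)

(* A module with a basis [e] of vertex vectors (with vertices [lab]) on which
   each arrow acts by a sum of edges [(i, x, j)], meaning [e i * x = e j + ...];
   [co] gives the coordinates. *)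
Record tree_basis (K : fieldType) (Q : quiver) (A : pzRingType) (io : {rmorphism K -> A})
    (E : vertex Q -> A) (X : arrow Q -> A) (d : nat) (lab : 'I_d -> vertex Q)
    (edges : seq ('I_d * arrow Q * 'I_d)) (M : lmodType A)
    (e : 'I_d -> M) (co : M -> 'I_d -> K) : Prop := {
  tb_decomp : forall z, z = \sum_i io (co z i) *: e i;
  tb_coD : forall z w i, co (z + w) i = co z i + co w i;
  tb_coZ : forall c z i, co (io c *: z) i = c * co z i;
  tb_coe : forall i j, co (e i) j = (i == j)%:R;
  tb_idem : forall a i, E a *: e i = if lab i == a then e i else 0;
  tb_arrow : forall x i,
    X x *: e i = \sum_(t <- edges | (t.1.1 == i) && (t.1.2 == x)) e t.2 }.

Section TreeModules.
Local Open Scope classical_set_scope.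
Variables (K : fieldType) (Q : quiver) (A : pzRingType).
Variables (io : {rmorphism K -> A}) (E : vertex Q -> A) (X : arrow Q -> A).
Hypothesis qg : quiver_generated io E X.

Section Generic.
Variables (d : nat) (lab : 'I_d -> vertex Q) (edges : seq ('I_d * arrow Q * 'I_d)).
Variables (M : lmodType A) (e : 'I_d -> M) (co : M -> 'I_d -> K).
Hypothesis tb : tree_basis io E X lab edges e co.
Implicit Types (z w : M) (x : arrow Q) (S T : pred 'I_d).

Lemma tree_arrow x z :
  X x *: z = \sum_(t <- edges | t.1.2 == x) io (co z t.1.1) *: e t.2.
Proof.
rewrite {1}(tb_decomp tb z) scaler_sumr.
under eq_bigr => i _ do rewrite (scalar_swap qg) (tb_arrow tb) scaler_sumr.
rewrite (exchange_big_dep (fun t => t.1.2 == x)) /=; last by move=> i t _ /andP[].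
apply: eq_bigr => t tx; rewrite (big_pred1 t.1.1) // => i.
by rewrite tx andbT eq_sym.
Qed.

Lemma tree_co0 i : co 0 i = 0.
Proof. by rewrite -(scale0r 0) -(rmorph0 io) (tb_coZ tb) mul0r. Qed.

Lemma tree_co_sum (J : Type) (r : seq J) (p : pred J) (F : J -> M) i :
  co (\sum_(j <- r | p j) F j) i = \sum_(j <- r | p j) co (F j) i.
Proof.
apply: (big_morph (fun z => co z i)) => [z w|]; first exact: (tb_coD tb).
exact: tree_co0.
Qed.

Lemma tree_co_idem a z i : co (E a *: z) i = if lab i == a then co z i else 0.
Proof.
rewrite {1}(tb_decomp tb z) scaler_sumr tree_co_sum (bigD1 i) //= big1 => [|j ji].
  rewrite (scalar_swap qg) (tb_idem tb) addr0; case: ifP => _.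
    by rewrite (tb_coZ tb) (tb_coe tb) eqxx mulr1.
  by rewrite scaler0 tree_co0.
rewrite (scalar_swap qg) (tb_idem tb); case: ifP => _; last by rewrite scaler0 tree_co0.
by rewrite (tb_coZ tb) (tb_coe tb) (negPf ji) mulr0.
Qed.

Lemma tree_coB z w i : co (z - w) i = co z i - co w i.
Proof. by rewrite -scaleN1r -(rmorphN1 io) (tb_coD tb) (tb_coZ tb) mulN1r. Qed.

Definition vanishing S : set M := [set z | forall i, S i -> co z i = 0].

(** A coordinate in [S] receives contributions only from coordinates in [S], so vanishing on [S] is
    stable under arrows. *)
Definition pred_closed S := all (fun t => S t.2 ==> S t.1.1) edges.

Lemma vanishing_submodule S : pred_closed S -> is_submodule (vanishing S).
Proof.
move=> /allP Scl; apply: (submodule_gen qg) => [i _|z w z0 w0 i Si|c z z0 i Si|a z z0 i Si|x z z0 i Si].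
- exact: tree_co0.
- by rewrite (tb_coD tb) z0 // w0 // addr0.
- by rewrite (tb_coZ tb) z0 // mulr0.
- by rewrite tree_co_idem z0 //; case: ifP.
rewrite tree_arrow tree_co_sum big_seq_cond big1 // => t /andP[te _].
rewrite (tb_coZ tb) (tb_coe tb); case: eqP => [ti|_]; last by rewrite mulr0.
by rewrite z0 ?mul0r //; move: (Scl t te); rewrite ti Si.
Qed.

Lemma vanishing_basis S i : ~~ S i -> vanishing S (e i).
Proof. by move=> Si j Sj; rewrite (tb_coe tb); case: eqP => // ij; rewrite ij Sj in Si. Qed.

Lemma vanishing_basisP S i : vanishing S (e i) -> ~~ S i.
Proof.
by move=> h; apply/negP => /h; rewrite (tb_coe tb) eqxx => /eqP; rewrite oner_eq0.
Qed.

Lemma vanishing_cover S T k : pred_closed S -> ~~ T k -> S =1 predU1 k T ->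
  is_maximal_submodule (vanishing S) (vanishing T).
Proof.
move=> Scl Tk ST; apply: (cover_codim1 (io := io) (v := e k)).
- exact: vanishing_submodule.
- by move=> z z0 i Ti; apply: z0; rewrite ST /= Ti orbT.
- exact: vanishing_basis.
- by move=> /vanishing_basisP; rewrite ST /= eqxx.
move=> z z0; exists (co z k) => i; rewrite ST tree_coB (tb_coZ tb) (tb_coe tb).
case: (i =P k) => [->|ik] /=; first by rewrite eqxx mulr1 subrr.
by move=> /orP[/eqP//|Ti]; rewrite (z0 i Ti) sub0r; case: eqP => [ki|_]; [case: ik | rewrite mulr0 oppr0].
Qed.

(** Lists of numbers let the side conditions for concrete trees be settled by computation. *)
Definition vanish_at (s : seq nat) := vanishing (fun i => nat_of_ord i \in s).

Lemma vanish_at_cover (s : seq nat) (k : 'I_d) : nat_of_ord k \notin s ->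
    pred_closed (fun i => nat_of_ord i \in nat_of_ord k :: s) ->
  is_maximal_submodule (vanish_at (nat_of_ord k :: s)) (vanish_at s).
Proof. by move=> ks cl; apply: vanishing_cover ks _. Qed.

Lemma vanishing0 S : S =1 xpred0 -> vanishing S = setT.
Proof. by move=> S0; apply/seteqP; split=> // z _ i; rewrite S0. Qed.

Lemma vanishingT S : S =1 xpredT -> vanishing S = [set 0].
Proof.
move=> S1; apply/seteqP; split=> [z z0|_ -> i _]; last exact: tree_co0.
rewrite /= (tb_decomp tb z) big1 // => i _.
by rewrite z0 ?S1 // rmorph0 scale0r.
Qed.

Lemma vanish_at_nil : vanish_at [::] = setT.
Proof. exact: vanishing0. Qed.

Lemma vanish_at_subset (s s' : seq nat) : vanish_at s `<=` vanish_at s' ->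
  forall k : 'I_d, nat_of_ord k \notin s -> nat_of_ord k \notin s'.
Proof. by move=> ss' k ks; apply: vanishing_basisP (ss' _ (vanishing_basis ks)). Qed.

Lemma vanish_at1 (k : 'I_d) z : ~ vanish_at [:: nat_of_ord k] z -> co z k != 0.
Proof.
by apply: contra_notN => /eqP zk i; rewrite inE => /eqP/val_inj->.
Qed.

Lemma tree_basis_complete L k z : is_submodule L -> L z -> co z k != 0 ->
  (forall i, i != k -> L (e i)) -> L = setT.
Proof.
move=> Ls Lz zk Le.
have Lk : L (e k).
  apply: (scalar_closed_cancel (scalar_closedP io Ls) zk); move: Lz.
  rewrite {1}(tb_decomp tb z) (bigD1 k) //=; set r := \sum_(_ | _) _ => Lz.
  rewrite -[_ *: _](addrK r); apply: submodB => //.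
  by apply: submod_sum => // i /Le Li; apply: submodZ.
apply/seteqP; split=> // w _; rewrite (tb_decomp tb w).
apply: submod_sum => // i _; apply: submodZ => //.
by have [->|/Le] := eqVneq i k.
Qed.

(** When edges increase the numbering, every initial segment is closed under predecessors, and
    vanishing on these segments gives a composition series. *)
Lemma tree_has_length :
  all (fun t : 'I_d * arrow Q * 'I_d => (t.1.1 < t.2)%N) edges -> has_length M d.
Proof.
move=> /allP tri; pose V k := vanishing (fun i : 'I_d => (i < k)%N).
have cov k : (k < d)%N -> is_maximal_submodule (V k.+1) (V k).
  move=> kd; apply: (vanishing_cover (k := Ordinal kd)) => [||i] /=.
  - by apply/allP => t /tri lt; apply/implyP => /ltnW; apply: leq_trans.
  - by rewrite ltnn.
  - by rewrite ltnS leq_eqVlt.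
have ser k : (k <= d)%N -> exists2 s, series (V k) s setT & size s = k.
  elim: k => [_|k IH kd].
    by exists [::] => //=; apply: vanishing0 => i; rewrite ltn0.
  have [s sV sk] := IH (ltnW kd).
  by exists (V k :: s); rewrite /= ?sk //; split=> //; apply: cov.
have [s sV sk] := ser d (leqnn d).
exists s => //; apply/composition_seriesP.
by rewrite -(@vanishingT (fun i => (i < d)%N)) // => i; rewrite ltn_ord.
Qed.

Lemma tree_fg : finitely_generated M.
Proof.
by exists d, e => z; exists (fun i => io (co z i)); apply: (tb_decomp tb).
Qed.

End Generic.

(** * The five trees *)

Local Notation o3 k := (@Ordinal 3 k isT).
Local Notation o4 k := (@Ordinal 4 k isT).
Local Notation o5 k := (@Ordinal 5 k isT).

Variable M : lmodType A.
Implicit Types (x y z u : arrow Q) (L : set M).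

Lemma ord3_ind (P : 'I_3 -> Prop) : P (o3 0) -> P (o3 1) -> P (o3 2) -> forall i, P i.
Proof. by move=> ? ? ? [[|[|[|//]]] i]; rewrite (bool_irrelevance i isT). Qed.

Lemma ord4_ind (P : 'I_4 -> Prop) :
  P (o4 0) -> P (o4 1) -> P (o4 2) -> P (o4 3) -> forall i, P i.
Proof. by move=> ? ? ? ? [[|[|[|[|//]]]] i]; rewrite (bool_irrelevance i isT). Qed.

Lemma ord5_ind (P : 'I_5 -> Prop) :
  P (o5 0) -> P (o5 1) -> P (o5 2) -> P (o5 3) -> P (o5 4) -> forall i, P i.
Proof. by move=> ? ? ? ? ? [[|[|[|[|[|//]]]]] i]; rewrite (bool_irrelevance i isT). Qed.

Definition claw x y z : seq ('I_4 * arrow Q * 'I_4) :=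
  [:: (o4 0, x, o4 1); (o4 0, y, o4 2); (o4 0, z, o4 3)].

(** The length is 4, and [rad^2 M] lies in both the span of the vectors 1, 2 and the span of 1, 3.
    The module is local: an element with nonzero coordinate 0 generates it. *)
Lemma claw_not_serial x y z lab e co :
  x <> y -> x <> z -> y <> z -> tree_basis io E X lab (claw x y z) (M := M) e co ->
  indecomposable M /\ ~ (one_factor_serial M \/ two_factor_serial M).
Proof.
move=> /eqP xy /eqP xz /eqP yz tb.
have [yx zx zy] : [/\ y != x, z != x & z != y] by split; rewrite eq_sym.
pose V := vanish_at co.
have cW : is_maximal_submodule (V [:: 0%N]) setT.
  by rewrite -(vanish_at_nil co); apply: (vanish_at_cover tb (k := o4 0)).
have cU : is_maximal_submodule (V [:: 3; 0]%N) (V [:: 0%N]).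
  by apply: (vanish_at_cover tb (k := o4 3)).
have cU' : is_maximal_submodule (V [:: 2; 0]%N) (V [:: 0%N]).
  by apply: (vanish_at_cover tb (k := o4 2)).
have [Us _ _ _] := coverP cU; have [Us' _ _ _] := coverP cU'; have [Ws _ _ _] := coverP cW.
split; last first.
  apply: (not_factor_serial (tree_has_length tb _) _ Us Us') => //.
  - exact: rad_pow2_cover cW cU.
  - exact: rad_pow2_cover cW cU'.
  - by move=> /(vanish_at_subset tb)/(_ (o4 2))/(_ isT).
  - by move=> /(vanish_at_subset tb)/(_ (o4 3))/(_ isT).
apply: (indecomposable_local (N := V [:: 0%N])) => [|L Ls|//].
  by have [_ _ [w _ nw] _] := coverP cW => WT'; apply: nw; rewrite WT'.
have [|/not_subset[w Lw Nw]] := pselect (L `<=` V [:: 0%N]); [by right | left].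
have w0 : co w (o4 0) != 0 := vanish_at1 (k := o4 0) Nw.
have act u : L (X u *: w) by apply: submodZ.
have c1 i : L (io (co w (o4 0)) *: e i) -> L (e i).
  exact: scalar_closed_cancel (scalar_closedP io Ls) w0.
apply: (tree_basis_complete tb Ls Lw w0); elim/ord4_ind => // _; apply: c1.
- move: (act x); rewrite (tree_arrow tb) !big_cons big_nil /=.
  by rewrite eqxx (negPf yx) (negPf zx) addr0.
- move: (act y); rewrite (tree_arrow tb) !big_cons big_nil /=.
  by rewrite eqxx (negPf xy) (negPf zy) addr0.
- move: (act z); rewrite (tree_arrow tb) !big_cons big_nil /=.
  by rewrite eqxx (negPf xz) (negPf yz) addr0.
Qed.

Definition long_fork x y z : seq ('I_4 * arrow Q * 'I_4) :=
  [:: (o4 0, x, o4 1); (o4 0, y, o4 2); (o4 1, z, o4 3)].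

Lemma long_fork_not_serial x y z lab e co :
  x <> y -> tree_basis io E X lab (long_fork x y z) (M := M) e co ->
  indecomposable M /\ ~ (one_factor_serial M \/ two_factor_serial M).
Proof.
move=> /eqP xy tb; have yx : y != x by rewrite eq_sym.
pose V := vanish_at co.
have cW : is_maximal_submodule (V [:: 0%N]) setT.
  by rewrite -(vanish_at_nil co); apply: (vanish_at_cover tb (k := o4 0)).
have cU : is_maximal_submodule (V [:: 1; 0]%N) (V [:: 0%N]).
  by apply: (vanish_at_cover tb (k := o4 1)).
have cU' : is_maximal_submodule (V [:: 2; 0]%N) (V [:: 0%N]).
  by apply: (vanish_at_cover tb (k := o4 2)).
have [Us _ _ _] := coverP cU; have [Us' _ _ _] := coverP cU'; have [Ws _ _ _] := coverP cW.
split; last first.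
  apply: (not_factor_serial (tree_has_length tb _) _ Us Us') => //.
  - exact: rad_pow2_cover cW cU.
  - exact: rad_pow2_cover cW cU'.
  - by move=> /(vanish_at_subset tb)/(_ (o4 2))/(_ isT).
  - by move=> /(vanish_at_subset tb)/(_ (o4 1))/(_ isT).
apply: (indecomposable_local (N := V [:: 0%N])) => [|L Ls|//].
  by have [_ _ [w _ nw] _] := coverP cW => WT'; apply: nw; rewrite WT'.
have [|/not_subset[w Lw Nw]] := pselect (L `<=` V [:: 0%N]); [by right | left].
have w0 : co w (o4 0) != 0 := vanish_at1 (k := o4 0) Nw.
have act u v : L v -> L (X u *: v) by move=> Lv; apply: submodZ.
have c1 i : L (io (co w (o4 0)) *: e i) -> L (e i).
  exact: scalar_closed_cancel (scalar_closedP io Ls) w0.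
(* The arrow [z] may coincide with [x] or [y], hence a possible extra multiple of [e 3] for every
   [u]. *)
have Xu u : exists c, X u *: w = io (co w (o4 0)) *:
    (if x == u then e (o4 1) else if y == u then e (o4 2) else 0) + io c *: e (o4 3).
  exists (if z == u then co w (o4 1) else 0).
  rewrite (tree_arrow tb) !big_cons big_nil /=.
  have [<-|xu] := eqVneq x u; rewrite ?eqxx ?(negPf yx) ?addr0.
    by case: ifP; rewrite ?addr0 ?rmorph0 ?scale0r ?addr0.
  case: (y == u); rewrite ?scaler0 ?add0r.
    by case: ifP; rewrite ?addr0 ?rmorph0 ?scale0r ?addr0.
  by case: ifP; rewrite ?addr0 ?rmorph0 ?scale0r ?addr0.
(* The word [x z] isolates [e 3], which can then be subtracted from the images of [w] under single
   arrows. *)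
have L3 : L (e (o4 3)).
  apply: c1; have [c xE] := Xu x; have := act z _ (act x _ Lw).
  rewrite xE eqxx scalerDr !(scalar_swap qg) !(tb_arrow tb) !big_cons !big_nil /=.
  by rewrite eqxx scaler0 !addr0.
have Lu u : L (io (co w (o4 0)) *: (if x == u then e (o4 1) else if y == u then e (o4 2) else 0)).
  have [c uE] := Xu u; rewrite -[_ *: _](addrK (io c *: e (o4 3))) -uE.
  by apply: submodB => //; [apply: act | apply: submodZ].
apply: (tree_basis_complete tb Ls Lw w0); elim/ord4_ind => // _; apply: c1.
- by have := Lu x; rewrite eqxx.
- by have := Lu y; rewrite eqxx (negPf xy).
Qed.

Definition meeting x y : seq ('I_3 * arrow Q * 'I_3) :=
  [:: (o3 0, x, o3 2); (o3 1, y, o3 2)].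

(** Every nonzero submodule contains the vector 2, whereas the two sources 0 and 1 give two maximal
    submodules. *)
Lemma meeting_not_serial x y lab e co :
  x <> y -> tree_basis io E X lab (meeting x y) (M := M) e co ->
  indecomposable M /\ ~ (one_factor_serial M \/ two_factor_serial M).
Proof.
move=> /eqP xy tb; have yx : y != x by rewrite eq_sym.
have cU : is_maximal_submodule (vanish_at co [:: 0%N]) setT.
  by rewrite -(vanish_at_nil co); apply: (vanish_at_cover tb (k := o3 0)).
have cU' : is_maximal_submodule (vanish_at co [:: 1%N]) setT.
  by rewrite -(vanish_at_nil co); apply: (vanish_at_cover tb (k := o3 1)).
have [Us _ _ _] := coverP cU; have [Us' _ _ _] := coverP cU'.
split; last first.
  apply: (not_factor_serial (tree_has_length tb _) _ Us Us') => //.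
  - exact: rad_pow1_cover.
  - exact: rad_pow1_cover.
  - by move=> /(vanish_at_subset tb)/(_ (o3 1))/(_ isT).
  - by move=> /(vanish_at_subset tb)/(_ (o3 0))/(_ isT).
have e20 : e (o3 2) <> 0.
  move=> e0; have := tb_coe tb (o3 2) (o3 2).
  by rewrite e0 (tree_co0 tb) => /esym/eqP; rewrite oner_eq0.
apply: (indecomposable_socle e20) => L Ls.
have [|L2] := pselect (L (e (o3 2))); [by right | left].
apply/seteqP; split=> [w Lw|]; last exact: submod_ge0.
have c0 i : (L (io (co w i) *: e (o3 2))) -> co w i = 0.
  move=> Li; have [//|nz] := eqVneq (co w i) 0.
  by case: L2; apply: scalar_closed_cancel (scalar_closedP io Ls) nz Li.
rewrite /= (tb_decomp tb w) big1 // => i _; suff -> : co w i = 0 by rewrite rmorph0 scale0r.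
have w0 : co w (o3 0) = 0.
  apply: c0; have : L (X x *: w) by apply: submodZ.
  by rewrite (tree_arrow tb) !big_cons big_nil /= eqxx (negPf yx) addr0.
have w1 : co w (o3 1) = 0.
  apply: c0; have : L (X y *: w) by apply: submodZ.
  by rewrite (tree_arrow tb) !big_cons big_nil /= eqxx (negPf xy) addr0.
elim/ord3_ind: i => //; apply: c0; move: Lw.
rewrite {1}(tb_decomp tb w) (bigD1 (o3 2)) //= big1 ?addr0 //.
by elim/ord3_ind => // _; rewrite ?w0 ?w1 rmorph0 scale0r.
Qed.

(** The tree [0 -> 1], [1 -> 3], [1 -> 4] alone is 2-factor serial. The extra source 2, attached to
    3 by the same arrow [x], makes the top non-simple without splitting the module. *)
Definition late_fork u x y : seq ('I_5 * arrow Q * 'I_5) :=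
  [:: (o5 0, u, o5 1); (o5 1, x, o5 3); (o5 1, y, o5 4); (o5 2, x, o5 3)].

Lemma late_fork_not_serial u x y lab e co :
  u <> x -> u <> y -> x <> y -> tree_basis io E X lab (late_fork u x y) (M := M) e co ->
  indecomposable M /\ ~ (one_factor_serial M \/ two_factor_serial M).
Proof.
move=> /eqP ux /eqP uy /eqP xy tb.
have [xu yu yx] : [/\ x != u, y != u & y != x] by split; rewrite eq_sym.
have cU : is_maximal_submodule (vanish_at co [:: 0%N]) setT.
  by rewrite -(vanish_at_nil co); apply: (vanish_at_cover tb (k := o5 0)).
have cU' : is_maximal_submodule (vanish_at co [:: 2%N]) setT.
  by rewrite -(vanish_at_nil co); apply: (vanish_at_cover tb (k := o5 2)).
have [Us _ _ _] := coverP cU; have [Us' _ _ _] := coverP cU'.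
split; last first.
  apply: (not_factor_serial (tree_has_length tb _) _ Us Us') => //.
  - by apply: subset_trans (@rad_pow_sub1 _ _ _) (rad_pow1_cover cU).
  - by apply: subset_trans (@rad_pow_sub1 _ _ _) (rad_pow1_cover cU').
  - by move=> /(vanish_at_subset tb)/(_ (o5 2))/(_ isT).
  - by move=> /(vanish_at_subset tb)/(_ (o5 0))/(_ isT).
have uE w : X u *: w = io (co w (o5 0)) *: e (o5 1).
  by rewrite (tree_arrow tb) !big_cons big_nil /= eqxx (negPf xu) (negPf yu) addr0.
have xE w : X x *: w = io (co w (o5 1) + co w (o5 2)) *: e (o5 3).
  rewrite (tree_arrow tb) !big_cons big_nil /= eqxx (negPf ux) (negPf yx) addr0.
  by rewrite -scalerDl -rmorphD.
have yE w : X y *: w = io (co w (o5 1)) *: e (o5 4).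
  by rewrite (tree_arrow tb) !big_cons big_nil /= eqxx (negPf uy) (negPf xy) addr0.
have coe i j := tb_coe tb i j.
have e_neq0 i : e i <> 0.
  move=> e0; have := coe i i.
  by rewrite e0 eqxx (tree_co0 tb) => /esym/eqP; rewrite oner_eq0.
split; first by exists (e (o5 0)).
(* Neither top nor socle is simple, so a decomposition is examined directly. The summand [U] with an
   element of nonzero coordinate 0 contains the vectors 1, 3 and 4. Arrows send elements of [V] to
   multiples of these, which must be 0; so the coordinates 0, 1, 2 vanish on [V], and [V] lies in
   [U]. *)
suff H U V : is_submodule U -> is_submodule V -> U `&` V = [set 0] ->
    (exists2 w, U w & co w (o5 0) != 0) -> V = [set 0].
  move=> U V Us1 Vs UV dec.
  have [w [v [Uw Vv E0]]] := dec (e (o5 0)).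
  have := coe (o5 0) (o5 0); rewrite E0 eqxx (tb_coD tb) => co1.
  have [w0|w0] := eqVneq (co w (o5 0)) 0; last by right; apply: (H U V) => //; exists w.
  left; apply: (H V U) => //; first by rewrite setIC.
  by exists v => //; move: co1; rewrite w0 add0r => ->; rewrite oner_eq0.
move=> Us1 Vs UV [w Uw w0].
have Uc i : U (io (co w (o5 0)) *: e i) -> U (e i).
  exact: scalar_closed_cancel (scalar_closedP io Us1) w0.
have U1 : U (e (o5 1)) by apply: Uc; rewrite -uE; apply: submodZ.
have U3 : U (e (o5 3)).
  have : U (X x *: e (o5 1)) by apply: submodZ.
  by rewrite xE !coe /= addr0 rmorph1 scale1r.
have U4 : U (e (o5 4)).
  have : U (X y *: e (o5 1)) by apply: submodZ.
  by rewrite yE !coe /= rmorph1 scale1r.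
have UV0 c i : U (e i) -> V (io c *: e i) -> c = 0.
  move=> Ui Vi; apply: (scalar_eq0 (io := io) _ (@e_neq0 i)).
  have : (U `&` V) (io c *: e i) by split=> //; apply: submodZ.
  by rewrite UV.
apply/seteqP; split=> [v Vv|]; last exact: submod_ge0.
have v0 : co v (o5 0) = 0 by apply: (UV0 _ _ U1); rewrite -uE; apply: submodZ.
have v1 : co v (o5 1) = 0 by apply: (UV0 _ _ U4); rewrite -yE; apply: submodZ.
have v2 : co v (o5 2) = 0.
  have : co v (o5 1) + co v (o5 2) = 0 by apply: (UV0 _ _ U3); rewrite -xE; apply: submodZ.
  by rewrite v1 add0r.
have : (U `&` V) v; last by rewrite UV.
split=> //; rewrite (tb_decomp tb v); apply: submod_sum => // i _.
have U0 c : c = 0 -> U (io c *: e i) by move=> ->; rewrite rmorph0 scale0r; case: Us1.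
by elim/ord5_ind: i U0 => U0; [apply: U0| apply: U0|apply: U0|apply: submodZ|apply: submodZ].
Qed.

Definition fork x y : seq ('I_3 * arrow Q * 'I_3) :=
  [:: (o3 0, x, o3 1); (o3 0, y, o3 2)].

Lemma fork_two_factor_serial_basis x y lab e co : x <> y -> tgt x <> tgt y ->
  tree_basis io E X lab (fork x y) (M := M) e co ->
  indecomposable M /\ two_factor_serial M.
Proof.
move=> /eqP xy txy tb; have yx : y != x by rewrite eq_sym.
have e_neq0 i : e i <> 0.
  move=> e0; have := tb_coe tb i i.
  by rewrite e0 eqxx (tree_co0 tb) => /esym/eqP; rewrite oner_eq0.
have xe : X x *: e (o3 0) = e (o3 1).
  by rewrite (tb_arrow tb) !big_cons big_nil /= eqxx (negPf yx) addr0.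
have ye : X y *: e (o3 0) = e (o3 2).
  by rewrite (tb_arrow tb) !big_cons big_nil /= eqxx (negPf xy) addr0.
have XX u v : X u *: (X v *: e (o3 0)) = 0.
  rewrite (tb_arrow tb) scaler_sumr big1_seq // => t /andP[_].
  by rewrite !inE => /orP[] /eqP ->; rewrite /= (tb_arrow tb) !big_cons big_nil.
have span (z : M) : exists c0 c1 c2, z = io c0 *: e (o3 0) +
    (io c1 *: (X x *: e (o3 0)) + io c2 *: (X y *: e (o3 0))).
  exists (co z (o3 0)), (co z (o3 1)), (co z (o3 2)).
  rewrite xe ye {1}(tb_decomp tb z) !big_ord_recl big_ord0 addr0.
  by congr (_ + (_ + _)); congr (io (co z _) *: e _); apply: val_inj.
have [xn yn] : X x *: e (o3 0) <> 0 /\ X y *: e (o3 0) <> 0 by rewrite xe ye.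
split; first exact: (fork_indecomposable qg xn XX span).
exact: (fork_two_factor_serial qg xn yn XX txy span).
Qed.

End TreeModules.

(** * Existence of tree modules *)

Section TreeRepresentation.
Local Open Scope classical_set_scope.
Variables (K : fieldType) (Q : quiver).
Local Notation KQ := (path_algebra K Q).
Variables (d : nat) (lab : 'I_d -> vertex Q) (edges : seq ('I_d * arrow Q * 'I_d)).
Implicit Types (a b : vertex Q) (x y : arrow Q) (s t : seq (arrow Q)).
Implicit Types (f g : KQ) (p q : qpath Q) (i j : 'I_d).

Definition edges_labelled := forall i x j, (i, x, j) \in edges ->
  lab i = src x /\ lab j = tgt x.

Definition tree_idem a : 'M[K]_d := diag_mx (\row_i (lab i == a)%:R).
Definition tree_arr x : 'M[K]_d := \sum_(t <- edges | t.1.2 == x) delta_mx t.1.1 t.2.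
Definition tree_word s : 'M[K]_d := foldr (fun x B => tree_arr x *m B) 1%:M s.
Definition tree_path p : 'M[K]_d := tree_idem (psource p) *m tree_word (parrows p).
Definition tree_rep f : 'M[K]_d := \sum_(p <- msupp f) f@_p *: tree_path p.

(** A necessary condition for a word to have a nonzero matrix, readable from the list of edges. *)
Fixpoint tree_walk i s : Prop :=
  if s is x :: s' then exists2 j, (i, x, j) \in edges & tree_walk j s' else True.

Hypothesis labP : edges_labelled.

Lemma tree_idem_delta a i j :
  tree_idem a *m delta_mx i j = (lab i == a)%:R *: (delta_mx i j : 'M_(d, d)).
Proof.
apply/matrixP => k l; rewrite mul_diag_mx !mxE.
by case: (k =P i) => [->//|_]; rewrite !mulr0.
Qed.

Lemma delta_tree_idem m a (i : 'I_m) j :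
  (delta_mx i j : 'M_(m, d)) *m tree_idem a = (lab j == a)%:R *: (delta_mx i j : 'M_(m, d)).
Proof.
apply/matrixP => k l; rewrite mul_mx_diag !mxE mulrC.
by case: (l =P j) => [->//|_]; rewrite andbF !mulr0.
Qed.

Lemma tree_idemM a b : tree_idem a *m tree_idem b = if a == b then tree_idem b else 0.
Proof.
rewrite mulmx_diag; case: eqP => [->|ab].
  by congr diag_mx; apply/matrixP => i j; rewrite !mxE -natrM mulnb andbb.
rewrite -[RHS](linear0 (@diag_mx K d)); congr diag_mx.
apply/matrixP => i j; rewrite !mxE -natrM mulnb.
by case: (lab j =P a) => [->|//]; case: eqP.
Qed.

Lemma tree_idem_sum : \sum_a tree_idem a = 1%:M.
Proof.
rewrite -linear_sum -diag_const_mx; congr diag_mx; apply/matrixP => i j.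
rewrite summxE mxE (bigD1 (lab j)) //= !mxE eqxx big1 ?addr0 // => a /negPf ne.
by rewrite mxE eq_sym ne.
Qed.

Lemma tree_idem_arr a x : tree_idem a *m tree_arr x = if a == src x then tree_arr x else 0.
Proof.
rewrite /tree_arr mulmx_sumr; transitivity
  (\sum_(t <- edges | t.1.2 == x) (a == src x)%:R *: delta_mx t.1.1 t.2 : 'M[K]_d).
  rewrite big_seq_cond [RHS]big_seq_cond; apply: eq_bigr => -[[i y] j] /= /andP[/labP[li _] /eqP <-].
  by rewrite tree_idem_delta li eq_sym.
rewrite -scaler_sumr; case: eqP => _; first by rewrite scale1r.
by rewrite scale0r.
Qed.

Lemma tree_arr_idem a x : tree_arr x *m tree_idem a = if tgt x == a then tree_arr x else 0.
Proof.
rewrite /tree_arr mulmx_suml; transitivity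
  (\sum_(t <- edges | t.1.2 == x) (tgt x == a)%:R *: delta_mx t.1.1 t.2 : 'M[K]_d).
  rewrite big_seq_cond [RHS]big_seq_cond; apply: eq_bigr => -[[i y] j] /= /andP[/labP[_ lj] /eqP <-].
  by rewrite delta_tree_idem lj.
rewrite -scaler_sumr; case: eqP => _; first by rewrite scale1r.
by rewrite scale0r.
Qed.

Lemma tree_word_cat s t : tree_word (s ++ t) = tree_word s *m tree_word t.
Proof. by elim: s => [|x s IH] /=; rewrite ?mul1mx // IH mulmxA. Qed.

Lemma tree_path_idem p a : tree_path p *m tree_idem a = if ptarget p == a then tree_path p else 0.
Proof.
rewrite /tree_path /ptarget; case/lastP: (parrows p) => [|s x] /=.
  by rewrite mulmx1 tree_idemM; case: eqP => // ->.
rewrite map_rcons last_rcons -cats1 tree_word_cat /= mulmx1 -!mulmxA tree_arr_idem.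
by case: eqP; rewrite // !mulmx0.
Qed.

Lemma tree_path_comp p q : tree_path p *m tree_path q = oapp tree_path 0 (path_comp p q).
Proof.
rewrite {2}/tree_path mulmxA tree_path_idem.
case: path_compP => [r pq rE|/eqP/negPf ->]; last by rewrite mul0mx.
by rewrite pq eqxx /= /tree_path -mulmxA -tree_word_cat /psource /parrows rE.
Qed.

Lemma tree_repw (D : {fset qpath Q}) f : (msupp f `<=` D)%fset ->
  tree_rep f = \sum_(p <- D) f@_p *: tree_path p.
Proof.
move=> le; rewrite /tree_rep (big_fset_incl _ le) //= => p _ /mcoeff_outdom ->.
by rewrite scale0r.
Qed.

Lemma tree_repD f g : tree_rep (f + g) = tree_rep f + tree_rep g.
Proof.
set D := (msupp f `|` msupp g)%fset.
rewrite (@tree_repw D (f + g)) ?msuppD_le //.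
rewrite (@tree_repw D f) ?fsubsetUl // (@tree_repw D g) ?fsubsetUr //.
by rewrite -big_split; apply: eq_bigr => p _; rewrite mcoeffD scalerDl.
Qed.

Lemma tree_rep0 : tree_rep 0 = 0.
Proof. by apply: (addrI (tree_rep 0)); rewrite -tree_repD !addr0. Qed.

Lemma tree_repU c p : tree_rep << c *g p >> = c *: tree_path p.
Proof. by rewrite (@tree_repw [fset p]%fset) ?msuppU_le // big_seq_fset1 mcoeffUU. Qed.

Lemma tree_repB f g : tree_rep (f - g) = tree_rep f - tree_rep g.
Proof.
by apply: (addIr (tree_rep g)); rewrite -tree_repD !subrK.
Qed.

Lemma tree_repM f g : tree_rep (f * g) = tree_rep f *m tree_rep g.
Proof.
elim/malgU_ind: f => [|f1 f2 IH1 IH2|c p]; first by rewrite mul0r tree_rep0 mul0mx.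
  by rewrite mulrDl !tree_repD mulmxDl IH1 IH2.
elim/malgU_ind: g => [|g1 g2 IH1 IH2|e q]; first by rewrite mulr0 tree_rep0 mulmx0.
  by rewrite mulrDr !tree_repD mulmxDr IH1 IH2.
rewrite -[X in tree_rep X]/(pa_mul _ _) pa_mulUU !tree_repU -scalemxAl -scalemxAr scalerA.
rewrite tree_path_comp; case: path_comp => [r|] /=; first by rewrite tree_repU.
by rewrite tree_rep0 scaler0.
Qed.

Lemma tree_rep_idem a : tree_rep (path_elt K (lazy_path a)) = tree_idem a.
Proof. by rewrite tree_repU scale1r /tree_path /= mulmx1. Qed.

Lemma tree_rep_arrow x : tree_rep (arrow_elt K x) = tree_arr x.
Proof. by rewrite tree_repU scale1r /tree_path /= mulmx1 tree_idem_arr eqxx. Qed.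

Lemma tree_rep1 : tree_rep 1 = 1%:M.
Proof.
rewrite -tree_idem_sum -[1 : KQ]/(pa_one K Q) /pa_one.
rewrite (big_morph tree_rep tree_repD tree_rep0).
by apply: eq_bigr => a _; rewrite tree_rep_idem.
Qed.

Lemma delta_tree_arr i x : (delta_mx 0 i : 'rV[K]_d) *m tree_arr x =
  \sum_(t <- edges | (t.1.1 == i) && (t.1.2 == x)) delta_mx 0 t.2.
Proof.
rewrite /tree_arr mulmx_sumr [RHS]big_mkcond [LHS]big_mkcond; apply: eq_bigr => t _.
rewrite andbC; case: (t.1.2 == x) => //=.
by rewrite mul_delta_mx_cond eq_sym; case: eqP.
Qed.

Lemma tree_word_walk i s : (delta_mx 0 i : 'rV[K]_d) *m tree_word s <> 0 -> tree_walk i s.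
Proof.
elim: s i => //= x s IH i; rewrite mulmxA delta_tree_arr mulmx_suml => nz.
apply: contrapT => no; apply: nz; rewrite big_seq_cond big1 // => -[[i' x'] j] /=.
move=> /and3P[te /eqP ii /eqP xx]; apply: contrapT => /IH jw; apply: no.
by exists j => //; rewrite -ii -xx.
Qed.

Lemma tree_path_walk p : tree_path p <> 0 -> exists i, tree_walk i (parrows p).
Proof.
move=> nz; apply: contrapT => no; apply: nz.
rewrite /tree_path [X in _ *m X](_ : _ = 0) ?mulmx0 //.
apply/row_matrixP => i; rewrite rowE linear0.
by apply: contrapT => /tree_word_walk iw; apply: no; exists i.
Qed.

End TreeRepresentation.

(** Bundled because the module structure on row vectors depends on the two proofs. *)
Record bound_tree (K : fieldType) (Q : quiver) (I : ideal (path_algebra K Q)) := BoundTree {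
  bt_dim : nat;
  bt_lab : 'I_bt_dim -> vertex Q;
  bt_edges : seq ('I_bt_dim * arrow Q * 'I_bt_dim);
  bt_labP : edges_labelled bt_lab bt_edges;
  bt_kill : forall f, I f -> tree_rep bt_lab bt_edges f = 0 }.

Section TreeModule.
Variables (K : fieldType) (Q : quiver) (I : ideal (path_algebra K Q)) (T : bound_tree I).
Local Notation KQ := (path_algebra K Q).
Local Notation R := (bound_quiver_algebra I).
Local Notation rep := (tree_rep (@bt_lab _ _ _ T) (@bt_edges _ _ _ T)).
Local Notation cl := (quot_class I).

Definition tree_module := 'rV[K]_(bt_dim T).
HB.instance Definition _ := GRing.Zmodule.on tree_module.

Definition tree_scale (g : R^c) (v : tree_module) : tree_module := v *m rep (repr (g : R)).

Lemma tree_scale_class f v : tree_scale (cl f) v = v *m rep f.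
Proof.
rewrite /tree_scale; congr (_ *m _).
apply/eqP; rewrite -subr_eq0 -tree_repB; apply/eqP/bt_kill.
by apply/quot_classP; rewrite quot_classK.
Qed.

Fact tree_scaleA (g h : R^c) v : tree_scale g (tree_scale h v) = tree_scale (g * h) v.
Proof.
elim/quot_ringW: g => g; elim/quot_ringW: h => h.
rewrite -[_ * _]/(cl h * cl g) -clM !tree_scale_class tree_repM ?mulmxA //.
exact: bt_labP.
Qed.

Fact tree_scale1 : left_id 1 tree_scale.
Proof. by move=> v; rewrite -[1]/(cl 1) tree_scale_class tree_rep1 mulmx1. Qed.

Fact tree_scaleDr : right_distributive tree_scale +%R.
Proof. by move=> g u v; rewrite /tree_scale mulmxDl. Qed.

Fact tree_scaleDl v : {morph tree_scale^~ v : g h / g + h}.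
Proof.
move=> g h; elim/quot_ringW: g => g; elim/quot_ringW: h => h.
by rewrite -quot_classD !tree_scale_class tree_repD mulmxDr.
Qed.

HB.instance Definition _ := GRing.Zmodule_isLmodule.Build R^c tree_module
  tree_scaleA tree_scale1 tree_scaleDr tree_scaleDl.

Definition tree_vec (i : 'I_(bt_dim T)) : tree_module := delta_mx 0 i.
Definition tree_coord (v : tree_module) (i : 'I_(bt_dim T)) : K := v 0 i.

Lemma tree_scale_const c (v : 'rV[K]_(bt_dim T)) : tree_scale (bqa_const I c) v = c *: v.
Proof.
rewrite /bqa_const tree_scale_class.
have -> : rep (c *: (1 : KQ)) = c *: 1%:M.
  rewrite -[1]/(pa_one K Q) /pa_one scaler_sumr (big_morph rep (@tree_repD _ _ _ _ _) (@tree_rep0 _ _ _ _ _)).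
  rewrite -(tree_idem_sum K (@bt_lab _ _ _ T)) scaler_sumr; apply: eq_bigr => a _.
  by rewrite malgUZ mulr1 tree_repU /tree_path /= mulmx1.
by rewrite -scalemxAr mulmx1.
Qed.

Lemma tree_scale_idem a i :
  tree_scale (bqa_idem I a) (tree_vec i) = if @bt_lab _ _ _ T i == a then tree_vec i else 0.
Proof.
rewrite tree_scale_class tree_rep_idem [LHS]delta_tree_idem.
by case: eqP => _; rewrite ?scale1r ?scale0r.
Qed.

Lemma tree_scale_arrow x i : tree_scale (bqa_arrow I x) (tree_vec i) =
  \sum_(t <- @bt_edges _ _ _ T | (t.1.1 == i) && (t.1.2 == x)) tree_vec t.2.
Proof.
rewrite tree_scale_class tree_rep_arrow; last exact: bt_labP.
exact: delta_tree_arr.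
Qed.

Lemma tree_module_basis :
  @tree_basis K Q R^c (bqa_const I) (bqa_idem I) (bqa_arrow I) (bt_dim T)
    (@bt_lab _ _ _ T) (@bt_edges _ _ _ T) tree_module tree_vec tree_coord.
Proof.
split.
- move=> z; rewrite [LHS]row_sum_delta; apply: eq_bigr => i _.
  exact: esym (tree_scale_const _ _).
- by move=> z w i; rewrite /tree_coord mxE.
- move=> c z i; apply: etrans (congr1 (fun v : 'rV[K]_(bt_dim T) => v 0 i) (tree_scale_const c z)) _.
  by rewrite mxE.
- by move=> i j; rewrite /tree_coord mxE eqxx eq_sym.
- exact: tree_scale_idem.
- exact: tree_scale_arrow.
Qed.

End TreeModule.

(** * The theorem *)

Section BoundTrees.
Variables (K : fieldType) (Q : quiver) (I : ideal (path_algebra K Q)).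
Hypothesis admI : admissible I.
Local Notation R := (bound_quiver_algebra I).
Local Notation arr := (arrow_elt K).
Variables (d : nat) (lab : 'I_d -> vertex Q) (edges : seq ('I_d * arrow Q * 'I_d)).
Hypothesis lab_src : all (fun t => lab t.1.1 == src t.1.2) edges.
Hypothesis lab_tgt : all (fun t => lab t.2 == tgt t.1.2) edges.

Definition tree_model := exists (M : lmodType R^c) (e : 'I_d -> M) (co : M -> 'I_d -> K),
  @tree_basis K Q R^c (bqa_const I) (bqa_idem I) (bqa_arrow I) d lab edges M e co.

Lemma tree_model_kill :
  (forall p i, tree_walk edges i (parrows p) -> forall f, I f -> f@_p = 0) -> tree_model.
Proof.
move=> walk0.
have labP : edges_labelled lab edges.
  move=> i x j te; move/allP: lab_src => /(_ _ te) /eqP.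
  by move/allP: lab_tgt => /(_ _ te) /eqP.
have kill f : I f -> tree_rep lab edges f = 0.
  move=> If; rewrite /tree_rep big1 // => p _.
  have [->|/tree_path_walk[i iw]] := pselect (tree_path K lab edges p = 0).
    by rewrite scaler0.
  by rewrite (walk0 p i iw f If) scale0r.
pose T := BoundTree labP kill.
exists (tree_module T), (@tree_vec _ _ _ T), (@tree_coord _ _ _ T).
exact: (tree_module_basis T).
Qed.

(** All walks have length at most 1, where elements of an admissible ideal have no terms. *)
Lemma tree_model_short :
  all (fun t => all (fun t' => t.2 != t'.1.1) edges) edges -> tree_model.
Proof.
move=> /allP nc; apply: tree_model_kill => p i iw f If; apply: (admissible_deg admI If).
rewrite /plength; case: (parrows p) iw => [|x [|y s]] //= [j ij [k jk _]].
by move/allP: (nc _ ij) => /(_ _ jk); rewrite eqxx.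
Qed.

(** Walks have length at most 2. A path of length 2 in the support of an element of [I] would lie in
    [I] by [monomial2], against the last hypothesis. *)
Lemma tree_model_long :
  (forall x y : arrow Q, tgt x = tgt y -> x = y) ->
  all (fun t => all (fun t' => all (fun t'' =>
    ~~ ((t.2 == t'.1.1) && (t'.2 == t''.1.1))) edges) edges) edges ->
  all (fun t => all (fun t' => (t.2 == t'.1.1) ==>
    `[< ~ I (arr t.1.2 * arr t'.1.2) >]) edges) edges ->
  tree_model.
Proof.
move=> indeg /allP nc3 /allP nI; apply: tree_model_kill => p i.
case pE: (parrows p) => [|x [|y [|z s]]] /= => [_|[j ij _]|[j ij [k jk _]]|[j ij [k jk [l kl _]]]] f If.
- by apply: (admissible_deg admI If); rewrite /plength pE.
- by apply: (admissible_deg admI If); rewrite /plength pE.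
- move/allP: (nI _ ij) => /(_ _ jk); rewrite eqxx /= => /asboolP nIxy.
  apply/eqP; apply: contra_notT nIxy => fp.
  have := monomial2 admI indeg _ If fp.
  by rewrite /plength pE (path_elt_word_cons K pE) word_cons /word big_seq1; apply.
- by move/allP: (nc3 _ ij) => /(_ _ jk)/allP/(_ _ kl); rewrite !eqxx.
Qed.

End BoundTrees.

Lemma not_prefix (T : eqType) (s t : seq T) : ~~ prefix s t -> ~~ prefix t s ->
  exists w x y s' t', [/\ s = w ++ x :: s', t = w ++ y :: t' & x <> y].
Proof.
elim: s t => [|x s IH] [|y t] //=.
have [<-|xy] := eqVneq x y => /= ps pt.
  have [w [x' [y' [s' [t' [-> -> ne]]]]]] := IH t ps pt.
  by exists (x :: w), x', y', s', t'.
by exists [::], x, y, s, t; split=> //; apply/eqP.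
Qed.

Section Nakayama.
Variables (K : fieldType) (Q : quiver) (I : ideal (path_algebra K Q)).
Hypothesis admI : admissible I.
Local Notation R := (bound_quiver_algebra I).
Local Notation arr := (arrow_elt K).
Local Notation qg := (@bqa_generated K Q I).
Implicit Types x y z : arrow Q.

Lemma arrow_mul_bound_composable x y : ~ I (arr x * arr y) -> tgt x = src y.
Proof.
move=> nI; apply: (@arrow_mul_composable K); move=> e.
by apply: nI; rewrite e; case: (idealP I).
Qed.

(** * Necessity of the conditions *)

Section Forward.
Hypothesis serial : forall M : lmodType R^c, finitely_generated M -> indecomposable M ->
  one_factor_serial M \/ two_factor_serial M.

Lemma Nakayama_indeg x y : tgt x = tgt y -> x = y.
Proof.
move=> txy; apply: contrapT => xy.
(* The default [tgt x] of [nth] is the label of the vector 2. *)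
have [|||M [e [co tb]]] := @tree_model_short K Q I admI 3
    (fun i => nth (tgt x) [:: src x; src y] i) (meeting x y).
- by rewrite /= !eqxx.
- by rewrite /= -txy !eqxx.
- by [].
have [ind ns] := meeting_not_serial qg xy tb.
exact/ns/serial/ind/(tree_fg tb).
Qed.

Lemma Nakayama_outdeg x y z : src x = src y -> src x = src z ->
  x <> y -> x <> z -> y <> z -> False.
Proof.
move=> sxy sxz xy xz yz.
have [|||M [e [co tb]]] := @tree_model_short K Q I admI 4
    (fun i => nth (src x) [:: src x; tgt x; tgt y; tgt z] i) (claw x y z).
- by rewrite /= sxy -sxz sxy !eqxx.
- by rewrite /= !eqxx.
- by [].
have [ind ns] := claw_not_serial qg xy xz yz tb.
exact/ns/serial/ind/(tree_fg tb).
Qed.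

Lemma Nakayama_fork x y z : src x = src y -> x <> y -> ~ I (arr x * arr z) -> False.
Proof.
move=> sxy xy nI; have txz := arrow_mul_bound_composable nI.
have [|||||M [e [co tb]]] := @tree_model_long K Q I admI 4
    (fun i => nth (src x) [:: src x; tgt x; tgt y; tgt z] i) (long_fork x y z).
- by rewrite /= sxy txz !eqxx.
- by rewrite /= !eqxx.
- exact: Nakayama_indeg.
- by [].
- by rewrite /= !andbT; apply/asboolP.
have [ind ns] := long_fork_not_serial qg xy tb.
exact/ns/serial/ind/(tree_fg tb).
Qed.

Lemma Nakayama_cont x y z : ~ I (arr x * arr y) -> ~ I (arr x * arr z) -> y = z.
Proof.
move=> nxy nxz; apply: contrapT => yz.
have txy := arrow_mul_bound_composable nxy; have txz := arrow_mul_bound_composable nxz.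
(* A continuation equal to [x] makes [x] a loop with nonzero square; the other continuation starts
   at the same vertex, which [Nakayama_fork] excludes. *)
have xy : x <> y.
  by move=> e; subst y; apply: (Nakayama_fork _ yz nxy); rewrite -txy.
have xz : x <> z.
  move=> e; subst z; apply: (@Nakayama_fork x y x _ _ nxz); last exact: nesym.
  by rewrite -txy -txz.
have [|||||M [e [co tb]]] := @tree_model_long K Q I admI 5
    (fun i => nth (src x) [:: src x; tgt x; tgt x; tgt y; tgt z] i) (late_fork x y z).
- by rewrite /= -txy -txz !eqxx.
- by rewrite /= !eqxx.
- exact: Nakayama_indeg.
- by [].
- by rewrite /= !andbT; apply/andP; split; apply/asboolP.
have [ind ns] := late_fork_not_serial qg xy xz yz tb.
exact/ns/serial/ind/(tree_fg tb).
Qed.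

(** At the first place where the paths differ, a nonempty common part contradicts [Nakayama_cont];
    if they differ at once, a second arrow on either contradicts [Nakayama_fork]. *)
Lemma Nakayama_paths s g : is_bound_path I s -> is_bound_path I g ->
    psource s = psource g -> ~~ initial_subpath s g -> ~~ initial_subpath g s ->
  (plength s + plength g = 2)%N.
Proof.
move=> bs bg sg; rewrite /initial_subpath sg eqxx /= => ps pg.
have [w [x [y [s' [g' [sE gE xy]]]]]] := not_prefix ps pg.
have [_ _ IMl IMr] := idealP I.
have sub p u v z1 z2 : is_bound_path I p -> parrows p = u ++ [:: z1, z2 & v] ->
    ~ I (arr z1 * arr z2).
  move=> bp pE Iz; apply: bp; rewrite path_elt_word pE word_cat !word_cons.
  by apply/IMl/IMl; rewrite mulrA; apply: IMr.
case/lastP: w sE gE => [|w u] sE gE; last first.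
  case: xy; apply: (@Nakayama_cont u).
    by apply: (sub s w s'); rewrite // sE cat_rcons.
  by apply: (sub g w g'); rewrite // gE cat_rcons.
have src_hd p z v : parrows p = z :: v -> src z = psource p.
  by move=> pE; have := qpathP p; rewrite /is_qpath -/(parrows p) pE /= => /andP[/eqP].
have sxy : src x = src y by rewrite (src_hd s x s' sE) (src_hd g y g' gE).
rewrite /plength sE gE /=.
case: s' sE => [|z s'] sE /=.
  case: g' gE => [|z g'] gE //=.
  have := sub g [::] g' y z bg gE.
  by move/(Nakayama_fork (esym sxy) (nesym xy)).
have := sub s [::] s' x z bs sE.
by move/(Nakayama_fork sxy xy).
Qed.

End Forward.

(** * Indecomposable modules under the conditions *)

Section Classification.
Hypothesis fgR : finitely_generated (R : lmodType K).
Hypothesis outdeg : forall a : vertex Q, (#|out_arrows a| <= 2)%N.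
Hypothesis indeg : forall x y, tgt x = tgt y -> x = y.
Hypothesis paths : forall s g : qpath Q, is_bound_path I s -> is_bound_path I g ->
  (0 < plength s)%N -> (0 < plength g)%N -> psource s = psource g ->
  ~~ initial_subpath s g -> ~~ initial_subpath g s -> (plength s + plength g = 2)%N.

Lemma bqa_classification (M : lmodType R^c) : finitely_generated M -> indecomposable M ->
  uniserial M \/ (exists x y, [/\ x <> y, src x = src y & two_factor_serial M]).
Proof.
move=> fgM indM.
apply: (classification qg indeg indM (scalar_spanned_fg (bqa_fg fgR) fgM)).
- move=> x y z sxy sxz xy; apply: contrapT => no.
  have := outdeg (src x); rewrite leqNgt => /negP; apply; apply/card_gt2P.
  exists x, y, z; split; [split|split]; rewrite ?inE ?sxy -?sxz ?sxy //.
  - by apply/eqP.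
  - by apply/eqP => yz; apply: no; right.
  - by apply/eqP => zx; apply: no; left.
- move=> x s y t sxy [z /wact_neq0/wprod_path[p [ps pE bp]]] [w /wact_neq0/wprod_path[q [qs qE bq]]].
  move=> npq nqp; have := paths bp bq.
  rewrite /plength pE qE /initial_subpath ps qs sxy eqxx pE qE /= => /(_ isT isT erefl npq nqp).
  by rewrite addSn addnS => -[].
- have [k nil] := wprod_nilpotent admI; exists k => t z /nil t0.
  by rewrite wact_wprod t0 scale0r.
Qed.

End Classification.

Lemma bqa_fork_module x y : (forall x y, tgt x = tgt y -> x = y) -> src x = src y -> x <> y ->
  exists M : lmodType R^c, [/\ finitely_generated M, indecomposable M & two_factor_serial M].
Proof.
move=> indeg sxy xy.
have [|||M [e [co tb]]] := @tree_model_short K Q I admI 3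
    (fun i => nth (src x) [:: src x; tgt x; tgt y] i) (fork x y).
- by rewrite /= sxy !eqxx.
- by rewrite /= !eqxx.
- by [].
have txy : tgt x <> tgt y by move/indeg.
have [ind tfs] := fork_two_factor_serial_basis qg xy txy tb.
by exists M; split=> //; apply: tree_fg tb.
Qed.

End Nakayama.

Theorem theorem5p13 (K : closedFieldType) (Q : quiver)
    (I : ideal (path_algebra K Q)) :
  admissible I ->
  finitely_generated (bound_quiver_algebra I : lmodType K) ->
  basic (bound_quiver_algebra I) ->
  connected (bound_quiver_algebra I) ->
  right_2_Nakayama (bound_quiver_algebra I) <->
  [/\ forall a : vertex Q,
        (#|out_arrows a| <= 2)%N /\ (#|in_arrows a| <= 1)%N,
      forall x y z : arrow Q,
        ~ I (arrow_elt K x * arrow_elt K y) ->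
        ~ I (arrow_elt K x * arrow_elt K z) -> y = z,
      exists a : vertex Q, #|out_arrows a| = 2%N
    & forall s g : qpath Q,
        is_bound_path I s -> is_bound_path I g ->
        (0 < plength s)%N -> (0 < plength g)%N ->
        psource s = psource g ->
        ~~ initial_subpath s g -> ~~ initial_subpath g s ->
        (plength s + plength g = 2)%N].
Proof.
move=> admI fgR _ _; split=> [[serial [M [fgM indM tfsM]]]|[deg _ [a a2] paths]].
  have indeg := Nakayama_indeg admI serial.
  have outdeg (a : vertex Q) : (#|out_arrows a| <= 2)%N.
    rewrite leqNgt; apply/negP => /card_gt2P[x [y [z [[]]]]].
    rewrite !inE => /eqP xa /eqP ya /eqP za [/eqP xy /eqP yz /eqP zx].
    apply: (Nakayama_outdeg admI serial (x := x) (y := y) (z := z)) => //; [|..|].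
    - by rewrite xa ya.
    - by rewrite xa za.
    - exact: nesym.
  have paths := Nakayama_paths admI serial.
  split=> [b|x y z||s g bs bg _ _]; [split=> //| | |exact: paths].
  - apply/card_le1_eqP => x y; rewrite !inE => /eqP xb /eqP yb.
    by apply: indeg; rewrite xb yb.
  - exact: Nakayama_cont.
  (* Without two arrows leaving a common vertex, the classification makes the given module [M]
     uniserial, although it is 2-factor serial. *)
  apply: contrapT => no.
  have [uM|[x [y [xy sxy _]]]] := bqa_classification admI fgR outdeg indeg
      (fun s g bs bg _ _ => paths s g bs bg) fgM indM.
    exact: uniserial_not_two_factor_serial uM tfsM.
  apply: no; exists (src x); apply/eqP; rewrite eqn_leq outdeg; apply/card_gt1P.
  by exists x, y; rewrite !inE -sxy !eqxx; split=> //; apply/eqP.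
have indeg (x y : arrow Q) : tgt x = tgt y -> x = y.
  have [_ /card_le1_eqP in1] := deg (tgt x) => txy.
  by apply: in1; rewrite !inE ?txy.
split=> [M fgM indM|].
  have [uM|[x [y [_ _ tfsM]]]] := bqa_classification admI fgR (fun a => (deg a).1) indeg paths fgM indM.
    by left; split=> //; case: indM.
  by right.
have /card_gt1P[x [y []]] : (1 < #|out_arrows a|)%N by rewrite a2.
rewrite !inE => /eqP xa /eqP ya /eqP xy.
by apply: (bqa_fork_module admI indeg _ xy); rewrite xa ya.
Qed.
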